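(* Let $p>2$ be a prime, let $F$ be a field of characteristic $p$, and let $n\in\mathbb{N}$ be such that $n\equiv p\pmod{p^2}$ and such that the partition $(n-p+1,1^{p-1})$ of $n$ is $p$-regular (equivalently, $n>p$). Then the vertices of the simple $F\mathfrak{S}_n$-module $D^{(n-p+1,1^{p-1})}$ are precisely the Sylow $p$-subgroups of $\mathfrak{S}_n$.
   Context: $\mathfrak{S}_n$ denotes the symmetric group of degree $n$. Modules are finite-dimensional left modules. For a partition $\lambda$ of $n$, $S^\lambda$ denotes the Specht $F\mathfrak{S}_n$-module labelled by $\lambda$ (James' convention). A partition is $p$-regular if no non-zero part is repeated $p$ or more times; for a $p$-regular partition $\lambda$, $D^\lambda:=S^\lambda/\mathrm{Rad}(S^\lambda)$ is the simple $F\mathfrak{S}_n$-module labelled by $\lambda$. For a finite group $G$ and an indecomposable $FG$-module $M$, a vertex of $M$ is a subgroup $Q$ of $G$ that is minimal with respect to the property that $M$ is isomorphic to a direct summand of $\mathrm{Ind}_Q^G(\mathrm{Res}_Q^G(M))$. The vertices of $M$ form a single $G$-conjugacy class of $p$-subgroups of $G$. *)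

(* Defs.v *)
From HB Require Import structures.
From mathcomp Require Import all_boot all_order all_algebra all_fingroup.
From mathcomp Require Import all_solvable mxrepresentation.
From mathcomp Require boolp.

Set Implicit Arguments.
Unset Strict Implicit.
Unset Printing Implicit Defensive.

Import GRing.Theory.
Local Open Scope ring_scope.

(* An FG-module is an mx_representation: row vectors with G acting on the     *)
(* right.  Products in {perm T} compose from left to right, so right modules  *)
(* for 'S_n are left modules for the symmetric group with the usual           *)
(* right-to-left composition.                                                 *)

Section Modules.
Variables (F : fieldType) (gT : finGroupType) (G : {group gT}).

Definition is_mx_rad n (rG : mx_representation F G n) (R : 'M[F]_n) : Prop :=
  forall v : 'rV[F]_n, (v <= R)%MS <->
    (forall U : 'M[F]_n, mxmodule rG U -> max_submod rG U 1%:M -> (v <= U)%MS).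

Lemma is_mx_rad_exists n (rG : mx_representation F G n) :
  exists R, is_mx_rad rG R.
Proof.
pose P U := mxmodule rG U /\ max_submod rG U 1%:M.
pose Q (R : 'M[F]_n) :=
  forall v : 'rV_n, (forall U, P U -> (v <= U)%MS) -> (v <= R)%MS.
suff H k (R : 'M[F]_n) : (\rank R <= k)%N -> Q R -> exists R', is_mx_rad rG R'.
  by apply: (H n 1%:M (rank_leq_row _)) => v _; apply: submx1.
elim: k R => [|k IHk] R rkR QR.
  exists R => v; split=> [vR U _ _ | vU]; last by apply: QR => U []; apply: vU.
  move: vR; rewrite leqn0 mxrank_eq0 in rkR; rewrite (eqP rkR) submx0.
  by move/eqP->; apply: sub0mx.
have [[U [PU nRU]]|noU] := boolp.pselect (exists U, P U /\ ~~ (R <= U)%MS).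
  apply: (IHk (R :&: U)%MS) => [|v Pv]; last by rewrite sub_capmx QR ?Pv.
  rewrite -ltnS (leq_trans _ rkR) //.
  by rewrite (ltn_leqif (mxrank_leqif_sup (capmxSl R U))) sub_capmx submx_refl.
exists R => v; split=> [vR U modU maxU | vU]; last by apply: QR => U []; apply: vU.
apply: submx_trans vR _; apply/negPn/negP=> nRU.
by apply: noU; exists U.
Qed.

Definition mx_rad n (rG : mx_representation F G n) : 'M[F]_n :=
  projT1 (boolp.cid (is_mx_rad_exists rG)).

Lemma mx_radP n (rG : mx_representation F G n) : is_mx_rad rG (mx_rad rG).
Proof. exact: (projT2 (boolp.cid _)). Qed.

Lemma mx_rad_module n (rG : mx_representation F G n) :
  mxmodule rG (mx_rad rG).
Proof.
apply/mxmoduleP=> x Gx; apply/row_subP=> i; rewrite row_mul.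
apply/mx_radP=> U modU maxU; apply: (mxmodule_trans modU Gx).
by move: U modU maxU; apply/mx_radP/row_sub.
Qed.

Definition head_repr n (rG : mx_representation F G n) :=
  factmod_repr (mx_rad_module rG).

Definition mx_indecomposable n (rG : mx_representation F G n) : Prop :=
  (0 < n)%N /\ forall U V : 'M[F]_n,
    mxmodule rG U -> mxmodule rG V ->
    (U + V :=: 1%:M)%MS -> (U :&: V = 0)%MS -> U = 0 \/ V = 0.

Definition mx_rsummand m n (rM : mx_representation F G m)
    (rN : mx_representation F G n) : Prop :=
  exists U V : 'M[F]_n, exists modU : mxmodule rN U,
    [/\ mxmodule rN V, (U + V :=: 1%:M)%MS, (U :&: V = 0)%MS
      & mx_rsim rM (submod_repr modU)].

End Modules.

Section Induction.
Variables (F : fieldType) (gT : finGroupType) (G Q : {group gT}).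
Hypothesis sQG : Q \subset G.
Variables (m : nat) (rQ : mx_representation F Q m).

(* For a right FQ-module W, the induced module is the direct sum of the       *)
(* W (x) t_i for t_i running over representatives of the right cosets of Q in *)
(* G, and (w (x) t_i) g = w (t_i g t_j^-1) (x) t_j if t_i g lies in Q :* t_j. *)
Definition coset_rep (i : 'I_#|rcosets Q G|) : gT := repr (enum_val i).

Definition induced_mx (g : gT) :=
  \mxblock_(i < #|rcosets Q G|, j < #|rcosets Q G|)
    (let h := (coset_rep i * g * (coset_rep j)^-1)%g in
     if h \in Q then rQ h else (0 : 'M[F]_m)).

Lemma coset_rep_eq i : enum_val i = (Q :* coset_rep i)%g.
Proof.
rewrite /coset_rep; have /rcosetsP[x Gx ->] := enum_valP i.
by rewrite rcoset_repr.
Qed.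

Lemma coset_rep_in i : coset_rep i \in G.
Proof.
rewrite /coset_rep; have /rcosetsP[x Gx ->] := enum_valP i.
have /rcosetP[q Qq ->] := mem_repr_rcoset Q x.
by rewrite groupM ?(subsetP sQG _ Qq).
Qed.

Lemma coset_repP g : g \in G ->
  exists j, forall k, (g * (coset_rep k)^-1 \in Q)%g = (k == j).
Proof.
move=> Gg; have gQ : (Q :* g)%g \in rcosets Q G by apply/rcosetsP; exists g.
exists (enum_rank_in gQ (Q :* g)%g) => k.
rewrite -mem_rcoset -coset_rep_eq.
apply/idP/eqP=> [gk | ->]; last by rewrite enum_rankK_in ?rcoset_refl.
apply: enum_val_inj; rewrite enum_rankK_in // coset_rep_eq.
by apply/esym/rcoset_eqP; rewrite -coset_rep_eq.
Qed.

Lemma induced_mx_repr : mx_repr G induced_mx.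
Proof.
split=> [|x y Gx Gy].
  rewrite -mxdiagZ; apply/eq_mxblockP=> i j /=; rewrite mulg1.
  have [k hk] := coset_repP (coset_rep_in i).
  have /eqP ik : (i == k) = true by rewrite -hk mulgV group1.
  rewrite hk -ik eq_sym; case: eqP => [<-|_]; last by [].
  by rewrite conform_mx_id mulgV repr_mx1.
rewrite /induced_mx mul_mxblock; apply/eq_mxblockP=> i j.
have [k hk] := coset_repP (groupM (coset_rep_in i) Gx).
rewrite (bigD1 k) //= big1 ?addr0 => [|l nlk]; last first.
  by rewrite hk (negPf nlk) mul0mx.
have Qk : (coset_rep i * x * (coset_rep k)^-1)%g \in Q by rewrite hk eqxx.
rewrite Qk.
have -> : (coset_rep i * (x * y) * (coset_rep j)^-1 =
  coset_rep i * x * (coset_rep k)^-1 * (coset_rep k * y * (coset_rep j)^-1))%g.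
  by rewrite !mulgA mulgKV.
rewrite groupMl //; case: ifP => Qkj; last by rewrite mulmx0.
by rewrite repr_mxM.
Qed.

Definition induced_repr := MxRepresentation induced_mx_repr.

End Induction.

Section Vertex.
Variables (F : fieldType) (gT : finGroupType) (G : {group gT}).
Variables (n : nat) (rG : mx_representation F G n).

Definition relatively_projective (Q : {group gT}) (sQG : Q \subset G) : Prop :=
  mx_rsummand rG (induced_repr sQG (subg_repr rG sQG)).

Definition is_vertex (Q : {group gT}) : Prop :=
  mx_indecomposable rG /\
  exists sQG : Q \subset G, relatively_projective sQG /\
    forall (R : {group gT}) (sRQ : R \subset Q),
      relatively_projective (subset_trans sRQ sQG) -> R :=: Q.

End Vertex.

Section PermutationModule.
Variables (F : fieldType) (gT : finGroupType) (G : {group gT}) (T : finType).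
Variable to : {action gT &-> T}.

Definition permutation_mx (g : gT) : 'M[F]_#|T| :=
  \matrix_(i, j) (to (enum_val i) g == enum_val j)%:R.

Definition basis_row (x : T) : 'rV[F]_#|T| := delta_mx 0 (enum_rank x).

Lemma basis_row_act x g :
  basis_row x *m permutation_mx g = basis_row (to x g).
Proof.
apply/rowP=> j; rewrite -rowE !mxE enum_rankK eqxx /=.
by rewrite eq_sym -(inj_eq enum_val_inj) enum_rankK.
Qed.

Lemma permutation_mx_repr : mx_repr G permutation_mx.
Proof.
split=> [|x y _ _]; apply/row_matrixP=> i;
  rewrite -[i]enum_valK !rowE -/(basis_row _).
  by rewrite basis_row_act act1 mulmx1.
by rewrite mulmxA !basis_row_act actM.
Qed.

Definition permutation_repr := MxRepresentation permutation_mx_repr.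

End PermutationModule.

Section Specht.
Variables (n : nat) (la : seq nat).

(* Nodes are (row, column), numbered from 0; t x is the node holding the      *)
(* entry x.  When la is a partition of n, an injective t with values in the   *)
(* diagram of la is a bijection onto it.                                      *)
Definition is_tableau (t : {ffun 'I_n -> 'I_n * 'I_n}) : bool :=
  injectiveb t && [forall x, ((t x).2 < nth 0%N la (t x).1)%N].

Record tableau := Tableau {
  node_of :> {ffun 'I_n -> 'I_n * 'I_n};
  _ : is_tableau node_of }.

HB.instance Definition _ := [isSub for node_of].
HB.instance Definition _ := [Finite of tableau by <:].

(* A tabloid is a row-equivalence class of tableaux, that is, the map sending *)
(* each entry to its row.                                                     *)
Definition rows_of (t : tableau) : {ffun 'I_n -> 'I_n} := [ffun x => (t x).1].

Record tabloid := Tabloid {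
  row_of :> {ffun 'I_n -> 'I_n};
  _ : row_of \in codom rows_of }.

HB.instance Definition _ := [isSub for row_of].
HB.instance Definition _ := [Finite of tabloid by <:].

Definition tabloid_of (t : tableau) : tabloid := Tabloid (codom_f rows_of t).

Lemma tableau_act_subproof (t : tableau) (s : 'S_n) :
  is_tableau [ffun x => t (s^-1%g x)].
Proof.
case: t => t /= /andP[/injectiveP inj_t /forallP dt]; apply/andP; split.
  by apply/injectiveP=> x y; rewrite !ffunE => /inj_t/perm_inj.
by apply/forallP=> x; rewrite ffunE.
Qed.

(* s replaces each entry x of t by s x *)
Definition tableau_act (t : tableau) (s : 'S_n) : tableau :=
  Tableau (tableau_act_subproof t s).

Lemma tabloid_act_subproof (r : tabloid) (s : 'S_n) :
  [ffun x => r (s^-1%g x)] \in codom rows_of.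
Proof.
case: r => r /= /codomP[t ->]; apply/codomP; exists (tableau_act t s).
by apply/ffunP=> x; rewrite !ffunE.
Qed.

Definition tabloid_act (r : tabloid) (s : 'S_n) : tabloid :=
  Tabloid (tabloid_act_subproof r s).

Lemma tabloid_act_is_action : is_action [set: 'S_n] tabloid_act.
Proof.
split=> [s r1 r2 /(congr1 val)/ffunP e | r s1 s2 _ _].
  by apply/val_inj/ffunP=> x; have := e (s x); rewrite !ffunE permK.
by apply/val_inj/ffunP=> x; rewrite !ffunE invMg permM.
Qed.

Canonical tabloid_action := Action tabloid_act_is_action.

Definition column_stab (t : tableau) : {set 'S_n} :=
  [set s : 'S_n | [forall x, (t (s x)).2 == (t x).2]].

Variable F : fieldType.

Definition tabloid_repr :=
  permutation_repr F [set: 'S_n]%G tabloid_action.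

Definition polytabloid (t : tableau) : 'rV[F]_#|{: tabloid}| :=
  \sum_(s in column_stab t)
    (-1) ^+ s *: basis_row F (tabloid_of (tableau_act t s)).

Definition specht_mx : 'M[F]_#|{: tabloid}| :=
  (\sum_(t : tableau) <<polytabloid t>>)%MS.

Lemma polytabloid_act t (s : 'S_n) :
  polytabloid t *m tabloid_repr s = polytabloid (tableau_act t s).
Proof.
rewrite mulmx_suml.
rewrite [RHS](reindex_inj (conjg_inj s)) /=.
apply: eq_big => [u|u _].
  rewrite !inE; apply/forallP/forallP=> H x.
    have := H (s^-1%g x); rewrite !ffunE.
    by rewrite conjgE !permM permK.
  have := H (s x); rewrite !ffunE.
  by rewrite conjgE !permM permK permK.
rewrite -scalemxAl basis_row_act; congr (_ *: basis_row F _).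
  by rewrite odd_permJ.
apply/val_inj/ffunP=> x; rewrite !ffunE /=.
by rewrite conjgE !invMg invgK !permM permK.
Qed.

Lemma specht_module : mxmodule tabloid_repr specht_mx.
Proof.
apply/mxmoduleP=> s _; rewrite /specht_mx sumsmxMr.
apply/sumsmx_subP=> t _; rewrite (eqmxMr _ (genmxE _)) polytabloid_act.
by rewrite (sumsmx_sup (tableau_act t s)) ?genmxE.
Qed.

Definition specht_repr := submod_repr specht_module.

(* the simple module D^la when la is a p-regular partition of n *)
Definition simple_repr := head_repr specht_repr.

End Specht.

Definition p_regular (p : nat) (la : seq nat) : Prop :=
  forall a, (0 < a)%N -> (count_mem a la < p)%N.

Definition hook (n p : nat) : seq nat := (n - p + 1)%N :: nseq p.-1 1%N.

Lemma hook_partition n p : (0 < p <= n)%N ->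
  [/\ sorted geq (hook n p), 0%N \notin hook n p & sumn (hook n p) = n].
Proof.
case/andP=> p0 pn; rewrite /hook; split.
- case: p p0 pn => //= -[|p] _ pn //=; rewrite addn1 /=.
  by elim: p {pn} => //= p ->.
- by rewrite in_cons negb_or addn1 /= mem_nseq andbF.
- by rewrite /= sumn_nseq mul1n -addnA add1n prednK // subnK.
Qed.

(* Main.v *)
Require Import Defs.
From mathcomp Require Import all_boot all_order all_algebra all_fingroup.
From mathcomp Require Import all_solvable mxrepresentation.
From mathcomp Require Import zify ring.

(** Write q = p - 1 and n = (N + 1) p, so that p divides N.

    By James' submodule theorem ([submodule_dichotomy]) D is the Specht module
    S of the hook modulo the radical of the invariant form.  S is spanned by
    vectors [wedge A], A being a q x n matrix whose rows have sum zero
    ([wedge_specht]): it is the q-th exterior power of the space of zero-sum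
    rows.  As p divides n, the all-one row is such a row, and [wedge A] lies
    in the radical when it is one of the rows of A ([hook_class_const]).

    If D is relatively Q-projective, the identity of D is the sum, over the
    right cosets B of Q, of endomorphisms f_B which the group permutes in the
    same way as it permutes the cosets.  Given two vectors t and v of D, the
    numbers phi(B) = < t f_B, v > add up to < t, v >.  If a p-group E fixes t
    and v and < t, v > is not 0, then phi is constant on the E-orbits of
    cosets, so that E fixes a coset and lies in a conjugate of Q
    ([fixed_pair_conj]).

    This argument is applied to a group that fixes the vectors only in part.
    Arrange the n points in N + 1 blocks of p points; let Y be the first block
    and X the union of the others, c the p-cycle of Y and z the product of the
    p-cycles of the blocks of X.  Let G1 be the group of the permutations that
    permute the blocks of X and rotate all blocks, the rotations of the blocks
    of X having total amount 0 modulo p.  Its Sylow p-subgroups have index p in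
    those of the symmetric group.  For a block b of X, let t be the wedge of
    the differences of consecutive points of b, and let v be the wedge of the
    layers, a layer being the sum of the points of X that have a given position
    in their blocks.  Both are fixed by c, and t is fixed by z; G1 moves t from
    block to block, and moves v.  But the sum of phi may be restricted first to
    the cosets fixed by c, then to those fixed by z as well, and on these phi is
    invariant under G1.  Hence a Sylow p-subgroup H of G1 lies in a conjugate of
    Q ([wreath_pair_conj]).

    The invariance of phi says that certain alternating forms take the same
    value at A and at A + A N, where N is the trace over <z> of a matrix of
    rank one and A N N = 0.  The values along the line A + x A N are those of a
    polynomial in x of degree less than p, and its derivative is a trace over
    <z> of p equal terms, that is, 0 ([altf_homotopy]).  The change of block of
    t is obtained in this way ([dform_step_class]), and so is the effect of the
    rotations on v ([dform_layer_class_wr]).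

    Finally, let E be generated by the p-cycles of two blocks.  It fixes two
    vectors built on other blocks, so that E also lies in a conjugate of Q.  If
    the p-part of |Q| were only |H|, then E would be conjugate to a subgroup of
    H.  This is impossible: a nontrivial element of G1 that moves at most p
    points moves exactly Y ([wreath_moved]), while the two p-cycles move
    disjoint sets.  Therefore |Q| is divisible by the p-part of n!
    ([relatively_projective_pfactor]).  As D is relatively projective for every
    subgroup of index prime to p, its vertices are the Sylow p-subgroups
    ([vertex_sylow]). *)

Set Implicit Arguments.
Unset Strict Implicit.
Unset Printing Implicit Defensive.

Import GroupScope GRing.Theory.
Local Open Scope ring_scope.

(** * Relative projectivity and cosets *)

Section RelativeProjectivity.
Variables (F : fieldType) (gT : finGroupType) (G : {group gT}).

(** Summands are handled through an inclusion and a retraction, which avoids the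
    complement and the base of the submodule. *)
Lemma rsummandP m n (rM : mx_representation F G m)
    (rN : mx_representation F G n) :
  mx_rsummand rM rN <->
  exists i : 'M[F]_(m, n), exists r : 'M[F]_(n, m),
    [/\ i *m r = 1%:M,
        forall x, x \in G -> rM x *m i = i *m rN x
      & forall x, x \in G -> rN x *m r = r *m rM x].
Proof.
split=> [[U [V [modU [modV UV1 UV0 simMU]]]] | [i [r [ir homi homr]]]].
  have [B [B' BB' homB]] := mx_rsim_def simMU.
  have mU : m = \rank U by case: simMU.
  have BB'1 : B *m B' = 1%:M.
    by move: B B' BB' {homB simMU}; rewrite -mU => B B'; apply: mulmx1C.
  pose P := proj_mx U V.
  have homP x : x \in G -> rN x *m P = P *m rN x.
    move=> Gx; have := proj_mx_hom UV0 modU modV.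
    rewrite UV1 => /(hom_mxP)/(_ x Gx); by rewrite !mul1mx.
  have PU : (P <= U)%MS by rewrite -[P]mul1mx proj_mx_sub.
  have [v [w [vw homv homw]]] : exists v : 'M[F]_(\rank U, n),
      exists w : 'M[F]_(n, \rank U), [/\ v *m w = 1%:M,
        forall x, x \in G -> submod_repr modU x *m v = v *m rN x
      & forall x, x \in G -> rN x *m w = w *m submod_repr modU x].
    exists (val_submod 1%:M), (in_submod U P); split.
    - rewrite in_submodE mulmxA proj_mx_id ?val_submodP //.
      by rewrite -in_submodE val_submodK.
    - move=> x Gx; rewrite -(val_submodJ modU) // mul1mx.
      by rewrite -val_submodE.
    - move=> x Gx; rewrite -(in_submodJ modU) //.
      rewrite -[proj_mx U V *m _]homP //.
      by rewrite [RHS]in_submodE -mulmxA -in_submodE.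
  move: (submod_repr modU) homB homv homw {simMU} => rU homB homv homw.
  exists (B *m v), (w *m B'); split.
  - by rewrite mulmxA -[B *m _ *m _]mulmxA vw mulmx1.
  - move=> x Gx; rewrite homB // -!mulmxA.
    by rewrite (mulmxA B') BB' mul1mx homv.
  move=> x Gx; rewrite homB // !mulmxA homw //.
  by rewrite -[w *m B' *m B]mulmxA BB' mulmx1.
have modU : mxmodule rN <<i>>%MS.
  apply/mxmoduleP=> x Gx; rewrite (eqmxMr _ (genmxE _)) genmxE -homi //.
  exact: submxMl.
exists <<i>>%MS, (kermx r), modU; split.
- apply/mxmoduleP=> x Gx; apply/sub_kermxP.
  by rewrite -mulmxA homr // mulmxA mulmx_ker mul0mx.
- apply/eqmxP; rewrite submx1 /=; apply/row_subP=> j; set v := row j _.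
  rewrite -[v](addrNK (v *m r *m i)) addmx_sub //.
    rewrite (submx_trans _ (addsmxSr _ _)) //; apply/sub_kermxP.
    by rewrite mulmxBl -[_ *m i *m r]mulmxA ir mulmx1 subrr.
  by rewrite (submx_trans _ (addsmxSl _ _)) // genmxE submxMl.
- apply/eqP; rewrite -submx0; apply/row_subP=> j.
  have: (row j (<<i>> :&: kermx r)%MS <= <<i>> :&: kermx r)%MS by apply: row_sub.
  rewrite sub_capmx genmxE => /andP[/submxP[w ->] /sub_kermxP].
  by rewrite -mulmxA ir mulmx1 => ->; rewrite mul0mx sub0mx.
have sI : (i <= <<i>>)%MS by rewrite genmxE.
have freei : row_free i by apply/row_freeP; exists r.
exists (in_submod _ i) => [||x Gx].
- by rewrite genmxE; apply/esym/eqP.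
- by rewrite /row_free mxrank_in_submod.
by rewrite -in_submodJ // -homi // [RHS]in_submodE -mulmxA -in_submodE.
Qed.

Variables (n : nat) (rG : mx_representation F G n).

(** Higman's criterion in the form of the trace of an endomorphism, kept as a
    family indexed by the cosets: f_A is the projection of the induced module
    to its summand of index A, read in the module through the inclusion and the
    retraction. *)
Lemma relatively_projective_coset_family (Q : {group gT}) (sQG : Q \subset G) :
  relatively_projective rG sQG ->
  exists f : {set gT} -> 'M[F]_n,
    \sum_(A in rcosets Q G) f A = 1%:M /\
    forall A g, A \in rcosets Q G -> g \in G -> f A *m rG g = rG g *m f (A :* g).
Proof.
case/rsummandP=> i [r [ir homi homr]].
pose e (A : {set gT}) : 'M[F]_(\sum_(j < #|rcosets Q G|) n) :=
  \mxdiag_(j < #|rcosets Q G|) ((enum_val j == A)%:R%:M : 'M[F]_n).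
have eI A g : g \in G -> e A *m induced_repr sQG (subg_repr rG sQG) g
    = induced_repr sQG (subg_repr rG sQG) g *m e (A :* g).
  move=> Gg; rewrite /= /induced_mx mul_mxdiag_mxblock mul_mxblock_mxdiag.
  apply/eq_mxblockP=> a b.
  case: ifP => Qab; last by rewrite mulmx0 mul0mx.
  rewrite -scalar_mxC; congr (_ *m _); congr (_%:R%:M); congr nat_of_bool.
  have -> : enum_val b = enum_val a :* g.
    rewrite !coset_rep_eq // -rcosetM; apply/esym/rcoset_eqP.
    by rewrite mem_rcoset.
  by rewrite (inj_eq (can_inj (rcosetK g))).
exists (fun A => i *m e A *m r); split=> [|A g _ Gg].
  rewrite -mulmx_suml -mulmx_sumr.
  suff -> : \sum_(A in rcosets Q G) e A = 1%:M by rewrite mulmx1.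
  rewrite -mxdiag_sum -[RHS]mxdiagZ; apply: eq_mxdiag => j.
  rewrite (bigD1 (enum_val j)) ?enum_valP //= eqxx big1 ?addr0 // => A.
  by case/andP=> _ /negPf; rewrite eq_sym => ->; rewrite raddf0.
by rewrite -mulmxA -homr // mulmxA -[_ *m e A *m _]mulmxA eI // !mulmxA homi.
Qed.

(** Averaging over the cosets of Q gives the inclusion in the induced module. *)
Lemma relatively_projective_index (Q : {group gT}) (sQG : Q \subset G) :
  #|G : Q|%:R != 0 :> F -> relatively_projective rG sQG.
Proof.
move=> nz; apply/rsummandP.
pose t := @coset_rep _ G Q.
have Gt j : t j \in G by apply: coset_rep_in.
exists (\mxrow_j (#|G : Q|%:R^-1 *: rG (t j)^-1%g)), (\mxcol_j rG (t j)); split.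
- rewrite mul_mxrow_mxcol.
  under eq_bigr do rewrite -scalemxAl -repr_mxM ?groupV // mulVg repr_mx1.
  rewrite sumr_const card_ord -[#|rcosets _ _|]/(#|G : Q|).
  by rewrite -scaler_nat scalerA divff ?scale1r.
- move=> x Gx; rewrite mul_mxrow /= /induced_mx mul_mxrow_mxblock.
  apply/eq_mxrow => j; rewrite -scalemxAr -repr_mxM ?groupV //.
  have [k' hk'] := coset_repP Q (groupM (Gt j) (groupVr Gx)).
  rewrite (bigD1 k') //= big1 ?addr0.
    have : (t j * x^-1 * (t k')^-1)%g \in Q by rewrite hk' eqxx.
    rewrite -groupV !invMg !invgK mulgA => Qk; rewrite Qk -scalemxAl -repr_mxM.
    - by rewrite !mulgA mulVg mul1g.
    - by rewrite groupV Gt.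
    exact: (subsetP sQG).
  move=> l nl; case: ifP; rewrite ?mulmx0 // -groupV !invMg !invgK mulgA hk'.
  by rewrite (negPf nl).
move=> x Gx; rewrite mxcol_mul /= /induced_mx mul_mxblock_mxrow.
apply/eq_mxcol => j.
have [k hk] := coset_repP Q (groupM (Gt j) Gx).
rewrite (bigD1 k) //= big1 ?addr0.
  have Qk : (t j * x * (t k)^-1)%g \in Q by rewrite hk eqxx.
  rewrite Qk -!repr_mxM ?mulgKV //; exact: (subsetP sQG).
by move=> l nl; rewrite hk (negPf nl) mul0mx.
Qed.

End RelativeProjectivity.

(** The orbits that are not reduced to a point have length divisible by p. *)
Lemma sum_fixed_points (F : fieldType) (p : nat) (aT : finGroupType)
    (T : finType) (to : {action aT &-> T}) (H : {group aT}) (S : {set T})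
    (phi : T -> F) :
  p \in [pchar F] -> (p.-group H)%g -> [acts H, on S | to] ->
  (forall x h, x \in S -> h \in H -> phi (to x h) = phi x) ->
  \sum_(x in S) phi x = \sum_(x in 'Fix_(S | to)(H)) phi x.
Proof.
move=> charF pH actS phiH.
pose S' := S :\: 'Fix_to(H).
have actS' : [acts H, on S' | to].
  by rewrite actsD ?acts_fix_norm ?normG.
rewrite (big_setID 'Fix_to(H)%act phi) /=.
suff -> : \sum_(x in S') phi x = 0 by rewrite addr0.
rewrite (set_partition_big _ (orbit_partition actS')) /=.
apply: big1 => O /imsetP[x]; rewrite in_setD => /andP[nfix Sx] ->.
rewrite (eq_bigr (fun=> phi x)) => [|_ /orbitP[h Hh <-]]; last exact: phiH.
rewrite sumr_const -mulr_natr; apply/eqP; rewrite mulf_eq0; apply/orP; right.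
rewrite -(dvdn_pcharf charF) card_orbit.
have /p_natP[k indk] : p.-nat #|H : 'C_H[x | to]|.
  exact: pnat_dvd (dvdn_indexg _ _) pH.
case: k indk => [ind1 | k ->]; last by rewrite expnS dvdn_mulr.
case/negP: nfix; apply/afixP=> h Hh.
have : H \subset 'C_H[x | to] by rewrite -indexg_eq1 ind1.
by move/subsetP/(_ h Hh)/setIP=> [_ /astab1P].
Qed.

Lemma rcoset_fixed_conj (gT : finGroupType) (Q H : {group gT}) (x : gT) :
  (forall h, h \in H -> (Q :* x :* h = Q :* x)%g) -> (H \subset Q :^ x)%g.
Proof.
move=> fixH; apply/subsetP=> h Hh; rewrite mem_conjg conjgE invgK.
have : (x * h)%g \in (Q :* x)%g by rewrite -(fixH h) // -rcosetM rcoset_refl.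
by rewrite mem_rcoset mulgA.
Qed.

(** * Alternating forms *)

Section AlternatingForms.
Variables (F : fieldType) (r n : nat) (I : finType).
Variables (c : I -> F) (R : I -> 'M[F]_(n, r)).

Definition set_row (V : nmodType) m k (A : 'M[V]_(m, k)) (l : 'I_m) (v : 'rV[V]_k) :=
  \matrix_(i, j) (if i == l then v 0 j else A i j).

(** Linear combinations of determinants; all alternating forms in the rows of A
    that occur below have this shape. *)
Definition altf (A : 'M[F]_(r, n)) := \sum_i c i * \det (A *m R i).

Lemma set_row_row (A : 'M[F]_(r, n)) l : set_row A l (row l A) = A.
Proof. by apply/matrixP=> i j; rewrite !mxE; case: eqP => // ->. Qed.

Lemma row_set_row m k (A : 'M[F]_(m, k)) l v : row l (set_row A l v) = v.
Proof. by apply/rowP=> j; rewrite !mxE eqxx. Qed.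

Lemma set_row_mulmx k (A : 'M[F]_(r, n)) l v (Z : 'M_(n, k)) :
  set_row A l v *m Z = set_row (A *m Z) l (v *m Z).
Proof.
apply/matrixP=> i j; rewrite !mxE.
have [->|il] := eqVneq i l; apply: eq_bigr => x _; rewrite !mxE ?eqxx //.
by rewrite (negPf il).
Qed.

Lemma set_row_submx (A : 'M[F]_(r, n)) m (K : 'M_(m, n)) l (v : 'rV_n) :
  (A <= K)%MS -> (v <= K)%MS -> (set_row A l v <= K)%MS.
Proof.
move=> AK vK; apply/row_subP=> i; have [-> | il] := eqVneq i l.
  by rewrite row_set_row.
rewrite (_ : row i _ = row i A) ?row_subP //.
  by apply: submx_trans (row_sub i A) AK.
by apply/rowP=> j; rewrite !mxE (negPf il).
Qed.

Lemma altf_mull (L : 'M[F]_r) A : altf (L *m A) = \det L * altf A.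
Proof.
rewrite /altf mulr_sumr; apply: eq_bigr => i _.
by rewrite -mulmxA det_mulmx mulrCA.
Qed.

Lemma altf_set_row_lin A l a u v :
  altf (set_row A l (a *: u + v)) = a * altf (set_row A l u) + altf (set_row A l v).
Proof.
rewrite /altf mulr_sumr -big_split; apply: eq_bigr => i _ /=.
rewrite mulrCA -mulrDr; congr (_ * _).
rewrite !set_row_mulmx -[\det (set_row _ _ (v *m _))]mul1r.
apply: (@determinant_multilinear _ _ _ _ _ l).
- by rewrite !row_set_row mulmxDl -scalemxAl scale1r.
- by apply/matrixP=> x j; rewrite !mxE eq_sym (negPf (neq_lift _ _)).
by apply/matrixP=> x j; rewrite !mxE eq_sym (negPf (neq_lift _ _)).
Qed.

Lemma altf_set_row0 A l : altf (set_row A l 0) = 0.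
Proof.
have := altf_set_row_lin A l 1 0 0; rewrite scale1r addr0 mul1r.
by move/eqP; rewrite -subr_eq0 opprD addNKr oppr_eq0 => /eqP.
Qed.

Lemma altf_add_row A l u :
  altf (A + delta_mx l 0 *m u) = altf A + altf (set_row A l u).
Proof.
rewrite -[altf A]mul1r -{2}(set_row_row A l) -altf_set_row_lin scale1r.
congr altf; apply/matrixP=> i j; rewrite [LHS]mxE [X in _ + X]mxE big_ord1.
rewrite [delta_mx _ _ _ _]mxE eqxx andbT [RHS]mxE.
have [-> | il] := eqVneq i l; first by rewrite mul1r !mxE.
by rewrite mul0r addr0.
Qed.

Lemma altf_set_row_sum A l (J : finType) (P : pred J) (v : J -> 'rV_n) :
  altf (set_row A l (\sum_(j | P j) v j)) = \sum_(j | P j) altf (set_row A l (v j)).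
Proof.
elim/big_rec2: _ => [|j x y _ <-]; first exact: altf_set_row0.
by rewrite -{1}[v j]scale1r altf_set_row_lin mul1r.
Qed.

Definition altf_poly (A B : 'M[F]_(r, n)) : {poly F} :=
  \sum_i c i *: \det (map_mx polyC (A *m R i) + 'X *: map_mx polyC (B *m R i)).

Lemma altf_polyE A B x : (altf_poly A B).[x] = altf (A + x *: B).
Proof.
rewrite /altf_poly /altf horner_sum; apply: eq_bigr => i _.
rewrite hornerZ; congr (_ * _); rewrite -[_.[x]]/(horner_eval x _) -det_map_mx.
congr (\det _); rewrite mulmxDl -scalemxAl.
move: (A *m R i) (B *m R i) => M N; apply/matrixP=> a b.
by rewrite !mxE /= /horner_eval !hornerE.
Qed.

(** Each entry of the matrix has degree at most 1. *)
Lemma size_altf_poly A B : (size (altf_poly A B) <= r.+1)%N.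
Proof.
apply: (leq_trans (size_sum _ _ _)); apply/bigmax_leqP=> i _.
apply: leq_trans (size_scale_leq _ _) _.
apply: (leq_trans (size_sum _ _ _)); apply/bigmax_leqP=> s _.
rewrite size_Msign; apply: leq_trans (size_poly_prod_leq _ _) _.
rewrite card_ord leq_subLR addnS ltnS addnn -muln2.
rewrite -[X in (_ <= X * 2)%N]card_ord -sum_nat_const; apply: leq_sum => a _.
rewrite !mxE.
apply: leq_trans (size_polyD _ _) _; rewrite geq_max.
rewrite (leq_trans (size_polyC_leq1 _)) // mulrC mul_polyC.
by rewrite (leq_trans (size_scale_leq _ _)) ?size_polyX.
Qed.

Lemma deriv_prod m (f : 'I_m -> {poly F}) :
  (\prod_i f i)^`() = \sum_l \prod_i (if i == l then (f i)^`() else f i).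
Proof.
elim: m f => [|m IHm] f; first by rewrite !big_ord0 derivC.
rewrite big_ord_recl derivM IHm [RHS]big_ord_recl; congr (_ + _).
  by rewrite big_ord_recl eqxx.
rewrite mulr_sumr; apply: eq_bigr => l _; rewrite [RHS]big_ord_recl /=.
by congr (_ * _).
Qed.

Lemma deriv_det m (M : 'M[{poly F}]_m) :
  (\det M)^`() = \sum_l \det (set_row M l (map_mx (@deriv _) (row l M))).
Proof.
rewrite /determinant raddf_sum exchange_big /=; apply: eq_bigr => s _.
rewrite -mulr_sumr !mulr_sign (fun_if (@deriv F)) derivN deriv_prod.
set u := \sum_(l < m) _; set v := \sum_(l < m) _; suff -> : u = v by [].
apply: eq_bigr => l _.
by apply: eq_bigr => i _; rewrite !mxE; case: eqP => // ->.
Qed.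

Lemma deriv_altf_poly A B x :
  (altf_poly A B)^`().[x] = \sum_l altf (set_row (A + x *: B) l (row l B)).
Proof.
rewrite /altf_poly /altf raddf_sum exchange_big /= horner_sum.
apply: eq_bigr => i _; rewrite derivZ hornerZ -mulr_sumr; congr (_ * _).
rewrite deriv_det horner_sum; apply: eq_bigr => l _.
rewrite -[_.[x]]/(horner_eval x _) -det_map_mx set_row_mulmx; congr (\det _).
rewrite mulmxDl -scalemxAl -row_mul; move: (A *m R i) (B *m R i) => M N.
apply/matrixP=> a b; rewrite !mxE /= /horner_eval.
by case: eqP => _; rewrite !(derivE, hornerE) ?mul1r ?mulr0 ?addr0 ?add0r.
Qed.

End AlternatingForms.

(** Throughout, p = r.+1 and z ^+ p = 1.  The form psi matters only on matrices
    with rows in K; there it is invariant under z and does not see the z-fixed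
    row u. *)
Section Homotopy.
Variables (F : fieldType) (r n : nat) (I : finType).
Variables (c : I -> F) (R : I -> 'M[F]_(n, r)).
Hypothesis charF : r.+1 \in [pchar F].
Variables (K : 'M[F]_n) (z : 'S_n) (u : 'rV[F]_n).
Local Notation Z i := (perm_mx (z ^+ i)%g : 'M[F]_n).
Local Notation Zi i := (perm_mx (z ^- i)%g : 'M[F]_n).
Local Notation psi := (altf c R).
Hypotheses (zp : (z ^+ r.+1)%g = 1%g) (uz : u *m perm_mx z = u).
Hypothesis Kz : (K *m perm_mx z <= K)%MS.
Hypothesis psi_inv : forall A, (A <= K)%MS -> psi (A *m perm_mx z) = psi A.
Hypothesis psi_u :
  forall A l, (A <= K)%MS -> psi (set_row A l u) = 0.

Variable e : 'M[F]_n.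
Hypotheses (eK : (e <= K)%MS) (ue : u *m e = 0).

Definition trace_mx := \sum_(i < r.+1) Zi i *m e *m Z i.

Let KZ i : (K *m Z i <= K)%MS.
Proof.
elim: i => [|i IHi]; first by rewrite expg0 perm_mx1 mulmx1.
rewrite expgSr perm_mxM mulmxA; apply: submx_trans (submxMr _ IHi) Kz.
Qed.

Let ZiE i : (i <= r.+1)%N -> (z ^- i = z ^+ (r.+1 - i))%g.
Proof. by move=> ir; apply/eqP; rewrite eq_invg_mul -expgD subnKC // zp. Qed.

Let KZi i : (i < r.+1)%N -> (K *m Zi i <= K)%MS.
Proof. by move=> ir; rewrite ZiE 1?ltnW //. Qed.

Let uZ i : u *m Z i = u.
Proof.
elim: i => [|i IHi]; first by rewrite expg0 perm_mx1 mulmx1.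
by rewrite expgSr perm_mxM mulmxA IHi uz.
Qed.

Let uZi i : u *m Zi i = u.
Proof. by rewrite -{1}(uZ i) -mulmxA -perm_mxM mulgV perm_mx1 mulmx1. Qed.

Lemma fixed_mul_trace : u *m trace_mx = 0.
Proof.
by rewrite mulmx_sumr big1 // => i _; rewrite !mulmxA uZi ue mul0mx.
Qed.

Lemma trace_mx_sub : (trace_mx <= K)%MS.
Proof.
apply: summx_sub => i _; rewrite -mulmxA.
apply: submx_trans (submxMl _ _) _; apply: submx_trans (KZ i).
exact: submxMr.
Qed.

Lemma trace_mx_comm : trace_mx *m perm_mx z = perm_mx z *m trace_mx.
Proof.
rewrite mulmx_suml mulmx_sumr [RHS](reindex_inj (@ordS_inj _)) /=.
apply: eq_bigr => i _; rewrite (expg_mod _ zp).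
rewrite -mulmxA -perm_mxM -expgSr !mulmxA -perm_mxM; congr (perm_mx _ *m _ *m _).
by rewrite expgSr invMg mulKVg.
Qed.

(** The derivative of psi at A in the direction A *m B. *)
Let dpsi (B : 'M[F]_n) (A : 'M[F]_(r, n)) :=
  \sum_l psi (set_row A l (row l (A *m B))).

(** The invariance of psi carries the conjugation by a power of z from e to the
    argument A. *)
Let dpsi_conj A i : (A <= K)%MS -> (i < r.+1)%N ->
  dpsi (Zi i *m e *m Z i) A = dpsi e (A *m Zi i).
Proof.
move=> AK ir; apply: eq_bigr => l _.
have psiZ B : (B <= K)%MS -> psi (B *m Z i) = psi B.
  elim: i {ir} => [|i IHi] BK; first by rewrite expg0 perm_mx1 mulmx1.
  rewrite expgSr perm_mxM mulmxA psi_inv ?IHi //.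
  exact: submx_trans (submxMr _ BK) (KZ i).
rewrite -[RHS]psiZ; last first.
  apply: set_row_submx; first exact: submx_trans (submxMr _ AK) (KZi ir).
  by rewrite (submx_trans (row_sub _ _)) // (submx_trans (submxMl _ _)).
rewrite set_row_mulmx -row_mul -!mulmxA -perm_mxM mulVg perm_mx1 mulmx1.
by rewrite !mulmxA.
Qed.

Variables (L : 'M[F]_r) (l0 : 'I_r).
Hypothesis detL : \det L = 1.

(** z acts on the rows of A by row operations, up to a multiple of u. *)
Let row_equivariant A := A *m perm_mx z = L *m A + delta_mx l0 0 *m u.

(** Row operations of determinant 1 do not change the value of an alternating
    form, and the multiple of u has no effect because psi vanishes when some row
    is u, and u *m e = 0. *)
Let dpsi_shift A : (A <= K)%MS -> row_equivariant A ->
  dpsi e (A *m perm_mx z) = dpsi e A.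
Proof.
move=> AK gA; rewrite /dpsi gA mulmxDl -[_ *m u *m e]mulmxA ue mulmx0 addr0.
rewrite -[RHS]mul1r -detL.
have -> : \sum_l psi (set_row A l (row l (A *m e)))
   = (altf_poly c R A (A *m e))^`().[0].
  rewrite deriv_altf_poly; apply: eq_bigr => l _.
  by rewrite scale0r addr0.
have polyL : altf_poly c R (L *m A) (L *m A *m e)
    = (\det L)%:P * altf_poly c R A (A *m e).
  rewrite /altf_poly mulr_sumr; apply: eq_bigr => i _.
  rewrite -!mulmxA !map_mxM /= scalemxAr -mulmxDr det_mulmx det_map_mx.
  by rewrite -scalerAr.
have -> : \det L * (altf_poly c R A (A *m e))^`().[0]
   = (altf_poly c R (L *m A) (L *m A *m e))^`().[0].
  by rewrite polyL derivM derivC mul0r add0r hornerM hornerC.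
rewrite deriv_altf_poly; apply: eq_bigr => l _.
rewrite scale0r addr0; set v := row l _.
have LAK : (L *m A <= K)%MS by apply: submx_trans (submxMl _ _) AK.
have vK : (v <= K)%MS.
  by rewrite (submx_trans (row_sub _ _)) // (submx_trans (submxMl _ _)).
have [-> | ll0] := eqVneq l l0.
  congr psi; apply/matrixP=> i j; rewrite [LHS]mxE [RHS]mxE.
  case: eqP => // /eqP nil; rewrite [LHS]mxE [X in _ + X]mxE big_ord1.
  rewrite [delta_mx _ _ _ _]mxE.
  by rewrite (negPf nil) mul0r addr0.
have -> : set_row (L *m A + delta_mx l0 0 *m u) l v =
   set_row (set_row (L *m A) l v) l0 (1 *: u + row l0 (L *m A)).
  apply/matrixP=> i j; rewrite [LHS]mxE [RHS]mxE [set_row _ _ _ _ _]mxE.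
  have [-> | il] := eqVneq i l; first by rewrite (negPf ll0).
  rewrite [LHS]mxE [X in _ + X]mxE big_ord1 [delta_mx _ _ _ _]mxE.
  case: eqP => [->|_]; last by rewrite mul0r addr0.
  by rewrite andbT mul1r scale1r !mxE addrC.
rewrite altf_set_row_lin psi_u ?set_row_submx // mulr0 add0r; congr psi.
apply/matrixP=> i j; rewrite !mxE; case: eqP => [->|//].
by rewrite eq_sym (negPf ll0).
Qed.

(** The p conjugates of e that make up the trace contribute equally. *)
Let dpsi0 A : (A <= K)%MS -> row_equivariant A -> dpsi trace_mx A = 0.
Proof.
move=> AK gA.
have -> : dpsi trace_mx A = \sum_(i < r.+1) dpsi (Zi i *m e *m Z i) A.
  rewrite [RHS]exchange_big; apply: eq_bigr => l _ /=.
  rewrite -altf_set_row_sum; congr (psi (set_row _ _ _)).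
  by rewrite mulmx_sumr raddf_sum.
rewrite (eq_bigr (fun=> dpsi e A)) => [|i _].
  by rewrite sumr_const card_ord -mulr_natr (pcharf0 charF) mulr0.
rewrite dpsi_conj //; case: i => i /=; elim: i => [|i IHi] ir.
  by rewrite expg0 invg1 perm_mx1 mulmx1.
rewrite -(IHi (ltnW ir)) -[RHS]/(dpsi e _).
have -> : A *m Zi i = A *m Zi i.+1 *m perm_mx z.
  by rewrite -mulmxA -perm_mxM expgS invMg mulgKV.
rewrite dpsi_shift //; first exact: submx_trans (submxMr _ AK) (KZi ir).
rewrite /row_equivariant -mulmxA -perm_mxM.
have -> : (z ^- i.+1 * z = z * z ^- i.+1)%g.
  exact: (commute_sym (commuteV (commuteX i.+1 (commute_refl z)))).
by rewrite perm_mxM mulmxA gA mulmxDl -!mulmxA uZi.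
Qed.

(** On the line A + x A N, where N is the trace of e, psi is a polynomial of
    degree at most r, smaller than p.  The hypothesis A N N = 0 gives
    (A + x A N) N = A N, so the derivative at x is the one of psi at A + x A N
    in the direction (A + x A N) N, which is 0 by [dpsi0].  A polynomial of
    degree less than p with derivative 0 is constant. *)
Theorem altf_homotopy A : (A <= K)%MS -> row_equivariant A ->
  A *m trace_mx *m trace_mx = 0 -> psi (A + A *m trace_mx) = psi A.
Proof.
move=> AK gA ANN; set N := trace_mx.
pose P := altf_poly c R A (A *m N).
have Px x : P.[x] = psi (A + x *: (A *m N)) by rewrite altf_polyE.
have P'0 x : P^`().[x] = 0.
  rewrite deriv_altf_poly; set Ax := A + _.
  have NK : (A *m N <= K)%MS := submx_trans (submxMl _ _) trace_mx_sub.
  have AxN : Ax *m N = A *m N by rewrite mulmxDl -scalemxAl ANN scaler0 addr0.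
  rewrite -[LHS]/(\sum_l psi (set_row Ax l (row l (A *m N)))) -AxN.
  apply: dpsi0; first by rewrite addmx_sub ?scalemx_sub.
  rewrite /row_equivariant mulmxDl -scalemxAl -mulmxA trace_mx_comm mulmxA gA.
  rewrite mulmxDl -[_ *m u *m _]mulmxA fixed_mul_trace mulmx0 addr0 mulmxDr.
  by rewrite -scalemxAr mulmxA addrAC.
have dP0 : P^`() = 0.
  apply/eqP/contraT => nz.
  (* The elements of the prime field are p roots of P'. *)
  pose s := [seq (i : nat)%:R : F | i <- iota 0 r.+1].
  have Us : uniq s.
    rewrite map_inj_in_uniq ?iota_uniq // => i j.
    rewrite !mem_iota !add0n /= => ir jr /eqP.
    wlog ij : i j ir jr / (i <= j)%N => [H|].
      by case/orP: (leq_total i j) => ? /eqP E; [|symmetry]; apply: H; rewrite ?E.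
    rewrite eq_sym -subr_eq0 -natrB // -(dvdn_pcharf charF) /dvdn modn_small.
      by rewrite subn_eq0 => ji; apply/eqP; rewrite eqn_leq ij.
    exact: leq_ltn_trans (leq_subr _ _) jr.
  have := max_poly_roots nz _ Us; rewrite size_map size_iota => H.
  have /H : all (root P^`()) s by apply/allP=> x _; rewrite /root P'0.
  rewrite ltnNge => /negP[]; have [->|nzP] := eqVneq P 0.
    by rewrite derivC size_poly0.
  rewrite -ltnS; apply: leq_trans (lt_size_deriv nzP) _.
  by rewrite ltnW // ltnS size_altf_poly.
have sP : (size P <= 1)%N.
  apply/leq_sizeP=> [[//|i]] _; have [ri | ir] := leqP r i.
    by apply: nth_default; apply: leq_trans (size_altf_poly _ _ _ _) _.
  have /eqP := congr1 (fun f : {poly F} => f`_i) dP0.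
  rewrite coef_deriv coef0 -mulr_natr mulf_eq0 => /orP[/eqP // |].
  by rewrite -(dvdn_pcharf charF) gtnNdvd.
rewrite -[A *m N]scale1r -Px (size1_polyC sP) !hornerC.
by have := Px 0; rewrite (size1_polyC sP) hornerC scale0r addr0 coefC.
Qed.

End Homotopy.

(** * Hook tableaux and tabloids *)

Section HookTableaux.
Variables (q m : nat).
Local Notation n := (q.+1 + m)%N.
Local Notation la := (hook n q.+1).
Local Notation tableau := (tableau n la).
Local Notation tabloid := (tabloid n la).

Lemma nth_hook i :
  nth 0%N la i = if i == 0%N then m.+1 else (i <= q)%N : nat.
Proof.
rewrite /hook; case: i => [|i] /=; first by rewrite addKn addn1.
by rewrite nth_nseq; case: ltnP.
Qed.

Definition hook_node (x : 'I_n) : 'I_n * 'I_n :=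
  if (x <= q)%N then (x, ord0) else (ord0, inord (x - q)).

Lemma hook_node1 x : (hook_node x).1 = (if (x <= q)%N then x : nat else 0%N) :> nat.
Proof. by rewrite /hook_node; case: leqP. Qed.

Lemma hook_node2 x : (hook_node x).2 = (x - q)%N :> nat.
Proof.
rewrite /hook_node; case: leqP => /= xq; first by apply/esym/eqP; rewrite subn_eq0.
by rewrite inordK //; apply: leq_ltn_trans (leq_subr _ _) (ltn_ord x).
Qed.

Lemma hook_node_inj : injective hook_node.
Proof.
move=> x y exy; apply/val_inj => /=.
move: (congr1 (fun u => val u.1) exy) (congr1 (fun u => val u.2) exy).
by rewrite /= !hook_node1 !hook_node2; do 2!case: ifP; lia.
Qed.

Lemma hook_tableau_subproof : is_tableau la [ffun x => hook_node x].
Proof.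
apply/andP; split.
  by apply/injectiveP=> x y; rewrite !ffunE; apply: hook_node_inj.
apply/forallP=> x; rewrite ffunE nth_hook hook_node1 hook_node2.
have xn := ltn_ord x; case: (leqP x q) => xq /=; last by lia.
by case: eqP => _; rewrite ?xq; lia.
Qed.

(** The tableau whose first column holds the points 0, ..., q in this order. *)
Definition hook_tableau : tableau := Tableau hook_tableau_subproof.
Local Notation t0 := hook_tableau.

Lemma tableau_hookP (t : tableau) : exists s, t = tableau_act t0 s.
Proof.
have ex x : exists y, t x == hook_node y.
  have := valP t; rewrite /= => /andP[_ /forallP/(_ x)].
  case: (val t x) => i j /=; rewrite nth_hook => hij.
  have [i0 | i0] := eqVneq i ord0; last first.
    exists i; apply/eqP; rewrite /hook_node.
    move: hij i0; rewrite -val_eqE /=; case: eqP => // _; case: (leqP i q) => //= _.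
    by rewrite ltnS leqn0 => /eqP j0 _; congr pair; apply/val_inj.
  have jn : (j + q < n)%N by move: hij; rewrite i0 /=; lia.
  have [j0 | j0] := posnP j.
    exists ord0; apply/eqP; rewrite i0 /hook_node /=.
    by congr pair; apply/val_inj.
  exists (Ordinal jn); apply/eqP; rewrite i0 /hook_node /= leqNgt.
  have -> : (q < j + q)%N by lia.
  by rewrite /= addnK inord_val.
pose f x := xchoose (ex x).
have fE x : t x = hook_node (f x) by apply/eqP/(xchooseP (ex x)).
have inj_t : injective t by case/andP: (valP t) => /injectiveP.
have inj_f : injective f.
  by move=> x y fxy; apply: inj_t; rewrite !fE fxy.
exists (perm inj_f)^-1%g; apply/val_inj/ffunP=> x.
by rewrite !ffunE invgK permE -fE.
Qed.

Definition hook_ext_fun (s : 'S_q.+1) (x : 'I_n) : 'I_n :=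
  match split x with inl i => lshift m (s i) | inr j => rshift q.+1 j end.

Lemma hook_ext_inj s : injective (hook_ext_fun s).
Proof.
have K : cancel (hook_ext_fun s) (hook_ext_fun s^-1).
  move=> x; rewrite /hook_ext_fun -[x in RHS]splitK.
  by case: (split x) => y; rewrite ?(unsplitK (inl _)) ?(unsplitK (inr _)) ?permK.
exact: can_inj K.
Qed.

Definition hook_ext s : 'S_n := perm (@hook_ext_inj s).

Lemma hook_extl s i : hook_ext s (lshift m i) = lshift m (s i).
Proof. by rewrite permE /hook_ext_fun (unsplitK (inl _)). Qed.

Lemma hook_extr s j : hook_ext s (rshift q.+1 j) = rshift q.+1 j.
Proof. by rewrite permE /hook_ext_fun (unsplitK (inr _)). Qed.

Lemma hook_extV s : (hook_ext s)^-1%g = hook_ext s^-1%g.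
Proof.
apply/permP=> x; apply: (@perm_inj _ (hook_ext s)); rewrite permKV.
by rewrite -[x]splitK; case: (split x) => y /=;
  rewrite ?hook_extl ?hook_extr ?permKV.
Qed.

Lemma hook_ext_injective : injective hook_ext.
Proof.
move=> s1 s2 e; apply/permP=> i; apply: (@lshift_inj _ m).
by rewrite -!hook_extl e.
Qed.

Lemma sign_hook_ext (F : fieldType) s :
  (-1) ^+ hook_ext s = (-1) ^+ s :> F.
Proof.
rewrite -!det_perm.
have -> : perm_mx (hook_ext s) = block_mx (perm_mx s) 0 0 1%:M :> 'M[F]_n.
  apply/matrixP=> x y; rewrite -[x]splitK -[y]splitK.
  case: (split x) => i; case: (split y) => j /=.
  - by rewrite block_mxEul !mxE hook_extl (inj_eq (@lshift_inj _ _)).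
  - by rewrite block_mxEur !mxE hook_extl eq_lrshift.
  - by rewrite block_mxEdl !mxE hook_extr eq_rlshift.
  - by rewrite block_mxEdr !mxE hook_extr (inj_eq (@rshift_inj _ _)).
by rewrite det_ublock det1 mulr1.
Qed.

Lemma hook_column_stab : column_stab t0 = [set hook_ext s | s : 'S_q.+1].
Proof.
have colE x : (t0 x).2 = (x - q)%N :> nat by rewrite ffunE hook_node2.
apply/setP=> s; rewrite inE; apply/forallP/imsetP=> [stab_s | [u _ ->] x]; last first.
  rewrite -val_eqE /= !colE -[x]splitK; case: (split x) => i /=.
    by rewrite hook_extl /=; have := ltn_ord i; have := ltn_ord (u i); lia.
  by rewrite hook_extr.
have stab x : (s x - q = x - q)%N.
  by rewrite -!colE; have /eqP -> := stab_s x.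
have ex i : exists j, s (lshift m i) == lshift m j.
  have := stab (lshift m i); rewrite /= => e.
  have sq : (s (lshift m i) < q.+1)%N by have := ltn_ord i; lia.
  by exists (Ordinal sq); apply/eqP/val_inj.
pose f i := xchoose (ex i).
have fE i : s (lshift m i) = lshift m (f i) by apply/eqP/(xchooseP (ex i)).
have inj_f : injective f.
  by move=> i j e; apply: (@lshift_inj _ m); apply: (@perm_inj _ s); rewrite !fE e.
exists (perm inj_f) => //; apply/permP=> x; rewrite -[x]splitK.
case: (split x) => j /=; first by rewrite hook_extl fE permE.
rewrite hook_extr; apply/val_inj; have := stab (rshift q.+1 j) => /=.
lia.
Qed.

Lemma hook_tabloidE s x :
  tabloid_act (tabloid_of t0) s x = (if (s^-1%g x <= q)%N then s^-1%g x : nat else 0%N) :> nat.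
Proof. by rewrite !ffunE hook_node1. Qed.

Lemma tabloidP (T : tabloid) : exists s, T = tabloid_act (tabloid_of t0) s.
Proof.
have /codomP[t eT] := valP T; have [s et] := tableau_hookP t.
exists s; apply/val_inj/ffunP=> x; by rewrite eT et !ffunE.
Qed.

(** A tabloid of hook shape is determined by its entries below the first row,
    since all other entries are in the first row. *)
Lemma tabloid_hook_extP (T : tabloid) (u : 'S_q.+1) :
  reflect (forall j : 'I_q, T (lshift m (u (lift ord0 j))) = j.+1 :> nat)
    (tabloid_act (tabloid_of t0) (hook_ext u) == T).
Proof.
apply: (iffP eqP) => [<- j | TE].
  by rewrite hook_tabloidE hook_extV hook_extl permK /= ltn_ord.
have [s eT] := tabloidP T; apply/val_inj/ffunP=> x; apply/val_inj.
rewrite -[LHS]/(nat_of_ord (tabloid_act _ _ x)) -[RHS]/(nat_of_ord (T x)).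
move: TE; rewrite eT => TE; rewrite !hook_tabloidE hook_extV.
have {}TE j : s^-1%g (lshift m (u (lift ord0 j))) = lshift m (lift ord0 j).
  apply/val_inj; have := TE j; rewrite hook_tabloidE.
  by case: ifP => // _ ->.
have inS y (i : 'I_q.+1) : i != ord0 -> s^-1%g y = lshift m i -> y = lshift m (u i).
  rewrite eq_sym => /unlift_some[j eij _] e; apply: (@perm_inj _ s^-1%g).
  by rewrite e eij TE.
have inU y (i : 'I_q.+1) : hook_ext u^-1%g y = lshift m i -> y = lshift m (u i).
  by rewrite -hook_extV => /(canRL (permKV _)); rewrite hook_extl.
have low (y : 'I_n) : (y <= q)%N -> exists i, y = lshift m i.
  by move=> yq; exists (Ordinal (yq : (y < q.+1)%N)); apply/val_inj.
case: ifP => [/low[i ei] | uq]; case: ifP => [/low[j ej] | sq] //.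
- rewrite ei ej /=; have [i0 | i0] := eqVneq i ord0.
    have [-> | j0] := eqVneq j ord0; first by rewrite i0.
    move: (inS _ _ j0 ej) (inU _ _ ei) => -> /lshift_inj/perm_inj eij.
    by rewrite eij i0 eqxx in j0.
  have xu := inU _ _ ei; move: i0; rewrite eq_sym => /unlift_some[k ik _].
  by move: ej; rewrite xu ik TE => /lshift_inj <-.
- have xu := inU _ _ ei; rewrite ei /=; have [-> // | i0] := eqVneq i ord0.
  move: i0; rewrite eq_sym => /unlift_some[k ik _].
  by move: sq; rewrite xu ik TE /= ltn_ord.
rewrite ej /=; have [-> // | j0] := eqVneq j ord0.
by move: uq; rewrite (inS _ _ j0 ej) -hook_extV -hook_extl permK /= -ltnS ltn_ord.
Qed.

End HookTableaux.

(** * The Specht module of a hook as an exterior power *)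

Lemma perm_extension (T : finType) k (f g : 'I_k -> T) :
  injective f -> injective g -> exists s : {perm T}, forall i, s (f i) = g i.
Proof.
elim: k f g => [|k IHk] f g injf injg; first by exists 1%g; case.
have [s sE] := IHk (fun i => f (lift ord_max i)) (fun i => g (lift ord_max i))
  (inj_comp injf (@lift_inj _ _)) (inj_comp injg (@lift_inj _ _)).
exists (s * tperm (s (f ord_max)) (g ord_max))%g => i; rewrite permM.
have [j -> | ->] := unliftP ord_max i; last by rewrite tpermL.
rewrite sE tpermD //; last by rewrite (inj_eq injg) neq_lift.
by rewrite -sE (inj_eq perm_inj) (inj_eq injf) neq_lift.
Qed.

Section HookWedge.
Variables (q m : nat) (F : fieldType).
Local Notation n := (q.+1 + m)%N.
Local Notation la := (hook n q.+1).
Local Notation tabloid := (tabloid n la).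
Local Notation t0 := (hook_tableau q m).
Local Notation T0 := (tabloid_of t0).
Local Notation pt := (lshift m : 'I_q.+1 -> 'I_n).
Local Notation tr := (tabloid_repr n la F).

(** Both sides are the determinant of G bordered by a row of ones: the left one
    by the Leibniz formula, the right one by subtracting the first column from
    the others. *)
Lemma det_diff (G : 'M[F]_(q, q.+1)) :
  \sum_(s : 'S_q.+1) (-1) ^+ s * \prod_i G i (s (lift ord0 i))
  = \det (\matrix_(i, j) (G i (lift ord0 j) - G i ord0)).
Proof.
pose M : 'M[F]_(1 + q) := col_mx (const_mx 1 : 'M_(1, 1 + q)) G.
have e0 : ord0 = lshift q (ord0 : 'I_1) by apply/val_inj.
have eS (i : 'I_q) : lift ord0 i = rshift 1 i by apply/val_inj.
have M0 j : M ord0 j = 1 by rewrite /M e0 col_mxEu mxE.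
have MS i j : M (lift ord0 i) j = G i j by rewrite /M eS col_mxEd.
transitivity (\det M).
  apply: eq_bigr => s _; congr (_ * _); rewrite big_ord_recl M0 mul1r.
  by apply: eq_bigr => i _; rewrite MS.
pose g : 'M[F]_(q, 1) := lsubmx (G : 'M_(q, 1 + q)).
pose G' : 'M[F]_q := rsubmx (G : 'M_(q, 1 + q)).
have -> : M = block_mx 1%:M 0 g 1%:M
           *m block_mx 1%:M (const_mx 1) 0 (G' - g *m const_mx 1).
  rewrite mulmx_block !(mul1mx, mul0mx, mulmx0, mulmx1, addr0) addrC subrK.
  rewrite /M -[G in LHS](hsubmxK (G : 'M_(q, 1 + q))) /block_mx; congr col_mx.
  by apply/matrixP=> i j; rewrite !mxE; case: splitP => k; rewrite !mxE ?ord1.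
rewrite det_mulmx det_lblock det_ublock !det1 !mul1r; congr (\det _).
apply/matrixP=> i j; rewrite !mxE big_ord1 !mxE mulr1 eS.
by congr (_ - G i _); apply/val_inj.
Qed.

Definition hookR (T : tabloid) : 'M[F]_(n, q) :=
  \matrix_(x, j) (T x == j.+1 :> nat)%:R.

(** The coordinate at T is the minor of A in the columns given by the entries of
    T below the first row; thus [wedge A] is the exterior product of the rows
    of A. *)
Definition wedge (A : 'M[F]_(q, n)) : 'rV[F]_#|{: tabloid}| :=
  \row_i \det (A *m hookR (enum_val i)).

Lemma wedgeE A T : wedge A 0 (enum_rank T) = \det (A *m hookR T).
Proof. by rewrite mxE enum_rankK. Qed.

(** This makes the results on alternating forms available for linear functions
    of [wedge A]. *)
Lemma wedge_altf A (C : 'cV[F]_#|{: tabloid}|) :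
  wedge A *m C =
  (altf (fun i => C i 0) (fun i => hookR (enum_val i)) A)%:M.
Proof.
apply/matrixP=> i j; rewrite !ord1 !mxE mulr1n.
by apply: eq_bigr => k _; rewrite mxE mulrC.
Qed.

Lemma wedge_act A (s : 'S_n) : wedge A *m tr s = wedge (A *m perm_mx s).
Proof.
have KV T : tabloid_act (tabloid_act T s^-1%g) s = T.
  by apply/val_inj/ffunP=> x; rewrite !ffunE invgK ?permK ?permKV.
have K T : tabloid_act (tabloid_act T s) s^-1%g = T.
  by apply/val_inj/ffunP=> x; rewrite !ffunE invgK ?permK ?permKV.
have trE i j : tr s i j = (tabloid_act (enum_val i) s == enum_val j)%:R.
  by rewrite mxE.
apply/rowP=> i; rewrite mxE [RHS]mxE.
rewrite (bigD1 (enum_rank (tabloid_act (enum_val i) s^-1%g))) //= big1 ?addr0.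
  rewrite wedgeE [permutation_mx _ _ _ _ _]trE enum_rankK KV eqxx mulr1 -mulmxA.
  congr (\det (_ *m _)); apply/matrixP=> x j.
  by rewrite -row_permE !mxE ffunE invgK.
move=> j nj; rewrite [permutation_mx _ _ _ _ _]trE; case: eqP => [e|_].
  by case/negP: nj; rewrite -e K enum_valK.
by rewrite mulr0.
Qed.

Lemma basis_row_repr (T : tabloid) (s : 'S_n) :
  basis_row F T *m tr s = basis_row F (tabloid_act T s).
Proof. exact: (basis_row_act F (tabloid_action n la)). Qed.

Definition hook_diff : 'M[F]_(q, n) :=
  \matrix_(i, x) ((x == pt (lift ord0 i))%:R - (x == pt ord0)%:R).

Lemma mul_hook_diff k (R : 'M[F]_(n, k)) i j :
  (hook_diff *m R) i j = R (pt (lift ord0 i)) j - R (pt ord0) j.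
Proof.
rewrite mxE; under eq_bigr do rewrite mxE mulrBl.
have sum1 y : \sum_x (x == y)%:R * R x j = R y j.
  rewrite (bigD1 y) // eqxx mul1r big1 /= => [|x /negPf->]; last by rewrite mul0r.
  exact: addr0.
by rewrite sumrB !sum1.
Qed.

Lemma polytabloid_hookE : polytabloid F t0 =
  \sum_(u : 'S_q.+1) (-1) ^+ u *: basis_row F (tabloid_act T0 (hook_ext m u)).
Proof.
rewrite /polytabloid hook_column_stab big_imset /=; last first.
  by move=> u v _ _; apply: hook_ext_injective.
apply: eq_big => [u|u _]; first by rewrite inE.
rewrite sign_hook_ext; congr (_ *: basis_row F _).
by apply/val_inj/ffunP=> x; rewrite !ffunE.
Qed.

(** The signed sum over the column stabilizer is, at each tabloid, a Leibniz sum
    as in [det_diff]. *)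
Lemma polytabloid_wedge : polytabloid F t0 = wedge hook_diff.
Proof.
apply/rowP=> i; rewrite [RHS]mxE -{1}(enum_valK i); move: (enum_val i) => T.
rewrite polytabloid_hookE summxE -det_tr.
transitivity (\sum_(u : 'S_q.+1) (-1) ^+ u *
    \prod_j (\matrix_(j < q, i < q.+1) hookR T (pt i) j) j (u (lift ord0 j))).
  apply: eq_bigr => u _; rewrite !mxE eqxx (inj_eq enum_rank_inj) eq_sym.
  congr (_ * _); case: tabloid_hook_extP => [TE | nTE].
    by rewrite big1 // => j _; rewrite !mxE TE eqxx.
  have [j nTj] : exists j : 'I_q, T (pt (u (lift ord0 j))) != j.+1 :> nat.
    by apply/existsP; rewrite -negb_forall; apply/negP=> /forallP TE;
       apply: nTE => j; apply/eqP/TE.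
  by rewrite (bigD1 j) //= !mxE (negPf nTj) mul0r.
rewrite det_diff; congr (\det _); apply/matrixP=> a b.
by rewrite mxE [RHS]mxE mul_hook_diff !mxE.
Qed.

(** Each term of the polytabloid picks a q x q minor of A.  Expanding it over
    'S_q and summing over the column stabilizer first gives the same bordered
    determinant q`! times. *)
Lemma polytabloid_pairing A :
  wedge A *m (polytabloid F t0)^T = (q`!%:R * \det (A *m hook_diff^T))%:M.
Proof.
rewrite polytabloid_hookE raddf_sum /= mulmx_sumr.
under eq_bigr => u _.
  rewrite linearZ /= -scalemxAr.
  rewrite (_ : wedge A *m _ = (\det (\matrix_(i, j) A i (pt (u (lift ord0 j)))))%:M).
    over.
  apply/matrixP=> a b; rewrite !ord1 [RHS]mxE mulr1n mxE.
  set T := tabloid_act _ _.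
  rewrite (bigD1 (enum_rank T)) //= big1 ?addr0 => [|k nk]; last first.
    by rewrite !mxE (negPf nk) mulr0.
  rewrite wedgeE !mxE !eqxx mulr1; congr (\det _); apply/matrixP=> i j.
  rewrite !mxE (bigD1 (pt (u (lift ord0 j)))) //= big1 ?addr0 => [|x nx].
    have /tabloid_hook_extP TE : T == T by [].
    by rewrite mxE TE eqxx mulr1.
  rewrite mxE; case: eqP => [|_]; rewrite ?mulr0 //.
  rewrite hook_tabloidE hook_extV.
  case: ifP => // xq xj; case/eqP: nx.
  have: hook_ext m u^-1%g x = pt (lift ord0 j) by apply/val_inj; rewrite /= xj.
  by rewrite -hook_extV => /(canRL (permKV _)); rewrite hook_extl.
under eq_bigr do rewrite scale_scalar_mx.
rewrite -raddf_sum; congr (_%:M).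
have detE (u : 'S_q.+1) : \det (\matrix_(i, j) A i (pt (u (lift ord0 j))))
   = \sum_(v : 'S_q) (-1) ^+ v * \prod_i A i (pt (u (lift ord0 (v i)))).
  by apply: eq_bigr => v _; congr (_ * _); apply: eq_bigr => i _; rewrite mxE.
under eq_bigr => u _ do rewrite detE mulr_sumr.
rewrite exchange_big /=.
rewrite (eq_bigr (fun=> \det (A *m hook_diff^T))) => [|v _].
  by rewrite sumr_const card_Sn mulr_natl.
transitivity (\sum_(u : 'S_q.+1) (-1) ^+ u *
    \prod_i (\matrix_(i < q, j < q.+1) A i (pt j)) i (u (lift ord0 i))); last first.
  rewrite det_diff; congr (\det _); apply/matrixP=> i j.
  rewrite -[A *m _]trmxK trmx_mul trmxK mxE [RHS]mxE mul_hook_diff.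
  by rewrite !mxE.
rewrite [RHS](reindex_inj (mulgI (lift0_perm v))) /=; apply: eq_bigr => u _.
rewrite mulrA odd_permM odd_lift_perm /= signr_addb [X in X * _]mulrC.
by congr (_ * _); apply: eq_bigr => i _; rewrite mxE permM lift0_perm_lift.
Qed.

Lemma polytabloid_act0 s :
  polytabloid F (tableau_act t0 s) = wedge (hook_diff *m perm_mx s).
Proof. by rewrite -polytabloid_act polytabloid_wedge -wedge_act. Qed.

Lemma wedge_hook_diff_specht s :
  (wedge (hook_diff *m perm_mx s) <= specht_mx n la F)%MS.
Proof.
by rewrite -polytabloid_act0 /specht_mx (sumsmx_sup (tableau_act t0 s)) ?genmxE.
Qed.

Lemma specht_sub m1 (U : 'M[F]_(m1, _)) :
  (forall s, (wedge (hook_diff *m perm_mx s) <= U)%MS) ->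
  (specht_mx n la F <= U)%MS.
Proof.
move=> WU; apply/sumsmx_subP=> t _; rewrite genmxE.
by have [s ->] := tableau_hookP t; rewrite polytabloid_act0.
Qed.

(** A row of sum zero is a combination of differences between points and the
    first point.  By multilinearity it is enough to let the row i be the difference of
    a point f i and the first point; [wedge] vanishes if the f i are not distinct
    or if one of them is the first point, and otherwise gives a polytabloid. *)
Lemma wedge_specht A :
  A *m const_mx 1 = 0 :> 'cV_q -> (wedge A <= specht_mx n la F)%MS.
Proof.
move=> A0.
pose D (f : {ffun 'I_q -> 'I_n}) : 'M[F]_(q, n) :=
  \matrix_(i, x) ((x == f i)%:R - (x == pt ord0)%:R).
have DR f k (R : 'M[F]_(n, k)) i j :
    (D f *m R) i j = R (f i) j - R (pt ord0) j.
  have sum1 y : \sum_x (x == y)%:R * R x j = R y j.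
    rewrite (bigD1 y) // eqxx mul1r big1 /= => [|x /negPf->]; last by rewrite mul0r.
    exact: addr0.
  rewrite mxE; under eq_bigr do rewrite mxE mulrBl.
  by rewrite sumrB !sum1.
have -> : wedge A = \sum_(f : {ffun 'I_q -> 'I_n}) (\prod_i A i (f i)) *: wedge (D f).
  apply/rowP=> T; rewrite summxE mxE.
  under [RHS]eq_bigr do rewrite mxE mxE.
  move: (hookR (enum_val T)) => R; rewrite /determinant.
  under [RHS]eq_bigr do rewrite mulr_sumr.
  rewrite exchange_big /=; apply: eq_bigr => s _.
  under [RHS]eq_bigr do rewrite mulrCA.
  rewrite -mulr_sumr; congr (_ * _).
  transitivity (\prod_i \sum_x A i x * (R x (s i) - R (pt ord0) (s i))).
    apply: eq_bigr => i _; rewrite mxE.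
    under [RHS]eq_bigr do rewrite mulrBr.
    rewrite sumrB -mulr_suml.
    have /matrixP/(_ i 0) := A0; rewrite !mxE => A0i.
    rewrite [X in _ - X * _](_ : _ = 0) ?mul0r ?subr0 //.
    by rewrite -[RHS]A0i; apply: eq_bigr => x _; rewrite mxE mulr1.
  rewrite bigA_distr_bigA /=; apply: eq_bigr => f _.
  by rewrite -big_split; apply: eq_bigr => i _; rewrite DR.
apply: summx_sub => f _; apply: scalemx_sub.
pose g (i : 'I_q.+1) := if unlift ord0 i is Some j then f j else pt ord0.
have [/injectiveP injg | ninj] := boolP (injectiveb g).
  have [s sE] := perm_extension (@lshift_inj q.+1 m) injg.
  suff -> : D f = hook_diff *m perm_mx s by apply: wedge_hook_diff_specht.
  apply/matrixP=> i x; rewrite mul_hook_diff !mxE !sE /g unlift_none liftK.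
  by rewrite ![_ == x]eq_sym.
have {ninj} /injectivePn[i [j ij gij]] := ninj.
suff -> : wedge (D f) = 0 by apply: sub0mx.
have base i' j' : i' != ord0 -> g i' = g j' -> j' != i' -> wedge (D f) = 0.
  rewrite eq_sym => /unlift_some[a -> _]; rewrite {1}/g liftK /g.
  case: unliftP => [b -> | -> fa _].
    move=> fab ab; apply/rowP=> T; rewrite mxE mxE.
    rewrite (@determinant_alternate _ _ _ a b) //.
      by apply: contraNneq ab => ->.
    by move=> k; rewrite !DR fab.
  apply/rowP=> T; rewrite mxE mxE (expand_det_row _ a) big1 // => k _.
  by rewrite DR fa subrr mul0r.
have [i0 | i0] := eqVneq i ord0; last by apply: (base i j); rewrite // eq_sym.
by apply: (base j i); rewrite // -i0 eq_sym.
Qed.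

Lemma tabloid_repr_tr s : (tr s)^T = tr s^-1%g.
Proof.
apply/matrixP=> i j; rewrite [LHS]mxE [LHS]mxE [RHS]mxE; congr (_%:R).
congr nat_of_bool; apply/eqP/eqP => [<- | <-]; apply/val_inj/ffunP=> x;
  by rewrite !ffunE !invgK ?permK ?permKV.
Qed.

Lemma hook_extM (u v : 'S_q.+1) : hook_ext m (u * v)%g = (hook_ext m u * hook_ext m v)%g.
Proof.
apply/permP=> x; rewrite permM -[x]splitK; case: (split x) => i /=.
  by rewrite !hook_extl permM.
by rewrite !hook_extr.
Qed.

Definition column_antisym := \sum_(u : 'S_q.+1) (-1) ^+ u *: tr (hook_ext m u).

(** If two points of the first column of t0 lie in the same row of T, exchanging
    them changes the sign and fixes the tabloid, so the result is its own
    opposite.  Otherwise T is a column permutation of t0. *)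
Lemma basis_row_antisym (two : 2%:R != 0 :> F) T :
  exists c, basis_row F T *m column_antisym = c *: polytabloid F t0.
Proof.
have E T' : basis_row F T' *m column_antisym
   = \sum_(u : 'S_q.+1) (-1) ^+ u *: basis_row F (tabloid_act T' (hook_ext m u)).
  rewrite mulmx_sumr; apply: eq_bigr => u _.
  by rewrite -scalemxAr basis_row_repr.
have actM' T' s s' : tabloid_act T' (s * s')%g = tabloid_act (tabloid_act T' s) s'.
  by apply/val_inj/ffunP=> x; rewrite !ffunE invMg permM.
have lowT (i : 'I_n) : (T i < q.+1)%N.
  have [s ->] := tabloidP T; rewrite hook_tabloidE; case: ifP => //.
have [/injectiveP injT | ninj] := boolP (injectiveb (fun i => Ordinal (lowT (pt i)))).
  pose u := (perm injT)^-1%g.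
  have /eqP <- : tabloid_act T0 (hook_ext m u) == T.
    apply/tabloid_hook_extP => j.
    have := permKV (perm injT) (lift ord0 j); rewrite permE => /(congr1 val) /= -> //.
  exists ((-1) ^+ u); rewrite E polytabloid_hookE scaler_sumr.
  rewrite [RHS](reindex_inj (mulgI u)) /=; apply: eq_bigr => v _.
  rewrite scalerA odd_permM signr_addb mulrA -signr_addb addbb mul1r.
  by rewrite hook_extM actM'.
have {ninj} /injectivePn[i [j ij Tij]] := ninj.
have {}Tij : T (pt i) = T (pt j).
  by apply/val_inj; have := congr1 val Tij.
exists 0; rewrite scale0r; set X := (X in X = 0).
suff : X = - X.
  move/eqP; rewrite -subr_eq0 opprK -mulr2n -scaler_nat scaler_eq0.
  by rewrite (negPf two) => /eqP.
rewrite {1}/X E (reindex_inj (mulgI (tperm i j))) /= /X E -sumrN.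
apply: eq_bigr => u _; rewrite odd_permM odd_tperm ij signr_addb mulN1r scaleNr.
congr (- (_ *: basis_row F _)); rewrite hook_extM actM'; congr (tabloid_act _ _).
apply/val_inj/ffunP=> x; rewrite ffunE hook_extV tpermV.
rewrite -[x]splitK; case: (split x) => k /=; last by rewrite hook_extr.
by rewrite hook_extl; case: tpermP => [->|->|].
Qed.

(** James' submodule theorem.  If some vector of U is not orthogonal to the
    polytabloid of t0, its image under the antisymmetrizer, which is symmetric
    for the form, is a nonzero multiple of that polytabloid; and the conjugates
    of the polytabloid span the Specht module. *)
Theorem submodule_dichotomy (two : 2%:R != 0 :> F) (U : 'M[F]_(#|{: tabloid}|)) :
  mxmodule tr U ->
  (specht_mx n la F <= U)%MS \/ U *m (specht_mx n la F)^T = 0.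
Proof.
move=> modU.
have eE : basis_row F T0 *m column_antisym = polytabloid F t0.
  rewrite mulmx_sumr polytabloid_hookE; apply: eq_bigr => u _.
  by rewrite -scalemxAr basis_row_repr.
have antisymT : column_antisym^T = column_antisym.
  rewrite /column_antisym raddf_sum /= [RHS](reindex_inj invg_inj) /=.
  apply: eq_bigr => u _; rewrite linearZ /= odd_permV.
  by rewrite [_^T]tabloid_repr_tr hook_extV.
have antisym_sub : (column_antisym <= polytabloid F t0)%MS.
  apply/row_subP=> i; rewrite rowE -(enum_valK i).
  by have [c ->] := basis_row_antisym two (enum_val i); rewrite scalemx_sub.
have [UE | UE] := eqVneq (U *m (polytabloid F t0)^T) 0.
  right; apply/trmx_inj; rewrite trmx_mul trmxK trmx0.
  apply/sub_kermxP; apply: specht_sub => s; apply/sub_kermxP/trmx_inj.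
  rewrite -wedge_act -polytabloid_wedge !trmx_mul trmxK trmx0.
  have /submxP[X UX] := mxmoduleP modU s^-1%g (in_setT _).
  by rewrite [(tr s)^T]tabloid_repr_tr mulmxA UX -mulmxA UE mulmx0.
left; have [i vE] : exists i, row i U *m (polytabloid F t0)^T != 0.
  apply/existsP; rewrite -negb_forall; apply: contra UE => /forallP UE.
  by apply/eqP/row_matrixP=> i; rewrite row_mul row0; apply/eqP.
have /sub_rVP[c vc] : (row i U *m column_antisym <= polytabloid F t0)%MS.
  exact: submx_trans (submxMl _ _) antisym_sub.
have c0 : c != 0.
  apply: contraNneq vE => c0.
  by rewrite -eE trmx_mul antisymT mulmxA vc c0 scale0r mul0mx.
have eU : (polytabloid F t0 <= U)%MS.
  rewrite -[polytabloid F t0](scalerK c0) -vc scalemx_sub // mulmx_sumr.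
  apply: summx_sub => u _; rewrite -scalemxAr scalemx_sub //.
  by apply: mxmodule_trans (modU) _ _; rewrite ?in_setT ?row_sub.
apply: specht_sub => s; rewrite -wedge_act -polytabloid_wedge.
by apply: mxmodule_trans (modU) _ _; rewrite ?in_setT.
Qed.

End HookWedge.

(** * The simple module and its invariant form *)

Section HookSimple.
Variables (q m : nat) (F : fieldType).
Local Notation n := (q.+1 + m)%N.
Local Notation la := (hook n q.+1).
Local Notation tabloid := (tabloid n la).
Local Notation pt := (lshift m : 'I_q.+1 -> 'I_n).
Local Notation tr := (tabloid_repr n la F).
Local Notation S := (specht_mx n la F).
Local Notation rS := (specht_repr n la F).
Local Notation rD := (simple_repr n la F).
Local Notation dS := (\rank S).
Local Notation rad := (mx_rad rS).
Local Notation d := (\rank (cokermx rad)).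

Hypothesis charF : q.+1 \in [pchar F].
Hypotheses (q1 : (1 < q)%N) (m0 : (0 < m)%N).

Lemma hook_two_neq0 : 2%:R != 0 :> F.
Proof. by rewrite -(dvdn_pcharf charF) gtnNdvd. Qed.

(** By Wilson's theorem q`! is -1 in F. *)
Lemma hook_fact_neq0 : q`!%:R != 0 :> F.
Proof.
have := Wilson (prime_gt1 (pcharf_prime charF)).
rewrite (pcharf_prime charF) (dvdn_pcharf charF) -natr1 => /esym/eqP qE.
by apply/negP=> /eqP q0; move: qE; rewrite q0 add0r => /eqP; rewrite oner_eq0.
Qed.

(** Of the matrix of the inclusion of S, only [valE] matters, not the base of S
    that it comes from. *)
Lemma specht_val_subproof :
  {v : 'M[F]_(dS, _) | forall k (W : 'M_(k, dS)), val_submod W = W *m v}.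
Proof. by exists (val_submod 1%:M) => k W; apply: val_submodE. Qed.

Definition specht_val := sval specht_val_subproof.
Local Notation v1 := specht_val.

Let valE k (W : 'M[F]_(k, dS)) : val_submod W = W *m v1.
Proof. exact: (svalP specht_val_subproof). Qed.

(** The Gram matrix of the restriction to S of the invariant form for which the
    tabloids are orthonormal. *)
Definition specht_gram : 'M[F]_dS := v1 *m v1^T.

Let v1S : (v1 :=: S)%MS. Proof. by rewrite -[v1]mul1mx -valE; apply: val_submod1. Qed.

Let v1J (x : 'S_n) : rS x *m v1 = v1 *m tr x.
Proof. by rewrite -valE -[rS x]mul1mx val_submodJ ?in_setT // valE mul1mx. Qed.

Let gramT : specht_gram^T = specht_gram.
Proof. by rewrite /specht_gram trmx_mul trmxK. Qed.

Lemma specht_gramJ (x : 'S_n) :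
  rS x *m specht_gram = specht_gram *m (rS x^-1%g)^T.
Proof.
rewrite /specht_gram mulmxA v1J -!mulmxA; congr (_ *m _).
by rewrite -trmx_mul v1J trmx_mul tabloid_repr_tr invgK.
Qed.

Let wedge_val A : A *m const_mx 1 = 0 :> 'cV_q ->
  in_submod S (wedge A) *m v1 = wedge A.
Proof. by move=> A0; rewrite -valE in_submodK // wedge_specht. Qed.

(** The differences between the points of the first column, save the first one,
    and a point y off this column pair with the polytabloid to q`!. *)
Lemma specht_gram_neq0 : specht_gram != 0.
Proof.
pose y : 'I_n := rshift q.+1 (Ordinal m0).
pose A : 'M[F]_(q, n) := \matrix_(i, x) ((x == pt (lift ord0 i))%:R - (x == y)%:R).
have A0 : A *m const_mx 1 = 0 :> 'cV_q.
  apply/matrixP=> i j; rewrite !mxE; under eq_bigr do rewrite !mxE mulr1.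
  have sum1 (x : 'I_n) : \sum_z (z == x)%:R = 1 :> F.
    by rewrite (bigD1 x) //= eqxx big1 ?addr0 // => z /negPf->.
  by rewrite sumrB !sum1 subrr.
have B0 : hook_diff q m F *m const_mx 1 = 0 :> 'cV_q.
  by apply/matrixP=> i j; rewrite mul_hook_diff !mxE subrr.
apply: contra hook_fact_neq0 => /eqP G0.
have := polytabloid_pairing A.
rewrite polytabloid_wedge -(wedge_val A0) -(wedge_val B0) trmx_mul -mulmxA.
rewrite (mulmxA v1) -/specht_gram G0 mul0mx mulmx0 => /matrixP/(_ 0 0).
rewrite !mxE mulr1n.
suff -> : A *m (hook_diff q m F)^T = 1%:M by rewrite det1 mulr1 => <-.
apply/matrixP=> i j; rewrite -[A *m _]trmxK trmx_mul trmxK mxE mul_hook_diff.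
rewrite !mxE !(inj_eq (@lshift_inj _ _)) !eq_lrshift !subr0 (inj_eq lift_inj).
by rewrite eq_sym.
Qed.

Lemma specht_submod_dichotomy (W : 'M[F]_dS) : mxmodule rS W ->
  (1%:M <= W)%MS \/ (W <= kermx specht_gram)%MS.
Proof.
move=> modW.
have modW' : mxmodule tr <<val_submod W>>%MS.
  by rewrite (eqmx_module _ (genmxE _)) (val_submod_module (specht_module n la F)).
case: (submodule_dichotomy hook_two_neq0 modW') => [SW | WS0].
  by left; rewrite -val_submodS val_submod1 (submx_trans SW) ?genmxE.
right; apply/sub_kermxP; rewrite /specht_gram mulmxA -valE.
have /submxP[X ->] : (v1 <= S)%MS by rewrite v1S.
have /submxP[Y ->] : (val_submod W <= <<val_submod W>>)%MS by rewrite genmxE.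
by rewrite trmx_mul mulmxA -[Y *m _ *m _]mulmxA WS0 mulmx0 mul0mx.
Qed.

Lemma specht_ker_module : mxmodule rS (kermx specht_gram).
Proof.
apply/mxmoduleP=> x _; apply/sub_kermxP.
by rewrite -mulmxA specht_gramJ mulmxA mulmx_ker mul0mx.
Qed.

Lemma specht_ker_max : max_submod rS (kermx specht_gram) 1%:M.
Proof.
have lt1 : ~~ (1%:M <= kermx specht_gram)%MS.
  by apply: contra specht_gram_neq0 => /sub_kermxP; rewrite mul1mx => ->.
split=> [|W [modW /andP[_ KW] /andP[_ W1]]]; first by rewrite ltmxE submx1.
by case: (specht_submod_dichotomy modW) => [W1' | WK]; [rewrite W1' in W1 | rewrite WK in KW].
Qed.

(** By the dichotomy every proper submodule of S is contained in the radical of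
    the form, which is therefore the only maximal submodule. *)
Lemma specht_rad : (rad :=: kermx specht_gram)%MS.
Proof.
apply/eqmxP/andP; split; apply/row_subP=> i.
  have /(mx_radP rS) := row_sub i rad.
  by apply; [exact: specht_ker_module | exact: specht_ker_max].
apply/(mx_radP rS) => U modU [/andP[_ U1] maxU].
case: (specht_submod_dichotomy modU) => [U1' | UK]; first by rewrite U1' in U1.
apply: submx_trans (row_sub _ _) _; apply/negPn/negP=> KU.
apply: (maxU (kermx specht_gram)); split; rewrite ?specht_ker_module //.
  by rewrite ltmxE UK.
by case: specht_ker_max.
Qed.

Lemma hook_simple_irreducible : mx_irreducible rD.
Proof.
have modR := mx_rad_module rS.
have maxR : max_submod rS rad 1%:M.
  apply: (max_submod_eqmx (eqmx_sym specht_rad) (eqmx_refl _)).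
  exact: specht_ker_max.
apply: (mx_rsim_irr (mx_factmod_sub modR)).
exact/(max_submodP modR (mxmodule1 rS) (submx1 _)).
Qed.

Lemma hook_simple_indecomposable : mx_indecomposable rD.
Proof.
have /mx_irrP[d0 irr] := hook_simple_irreducible.
split=> // U V modU modV _ UV0.
have [-> | U0] := eqVneq U 0; [by left | right].
have fullU := irr U modU U0.
apply/eqP; rewrite -submx0 -UV0 sub_capmx submx_refl andbT.
by rewrite -sub1mx in fullU; apply: submx_trans (submx1 _) fullU.
Qed.

(** Significant when the rows of A have sum zero, since then [wedge A] is in S. *)
Definition hook_class (A : 'M[F]_(q, n)) : 'rV[F]_d :=
  in_factmod rad (in_submod S (wedge A)).

Lemma simple_val_subproof :
  {v : 'M[F]_(d, dS) | forall k (W : 'M_(k, d)), val_factmod W = W *m v}.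
Proof. by exists (val_factmod 1%:M) => k W; apply: val_factmodE. Qed.

Definition simple_val := sval simple_val_subproof.
Local Notation vf := simple_val.

(** The form of S factors through D because its radical is the kernel of the
    projection; the lift given by [simple_val] can thus be any one. *)
Definition hook_form : 'M[F]_d := vf *m specht_gram *m vf^T.

Let vfE k (W : 'M[F]_(k, d)) : val_factmod W = W *m vf.
Proof. exact: (svalP simple_val_subproof). Qed.

Let gram_class k (W : 'M[F]_(k, dS)) :
  in_factmod rad W *m vf *m specht_gram = W *m specht_gram.
Proof.
rewrite -vfE -[in RHS](add_sub_fact_mod rad W) mulmxDl.
rewrite (_ : val_submod _ *m _ = 0) ?add0r //; apply/sub_kermxP.
by rewrite -specht_rad val_submodP.
Qed.

Let vfJ (x : 'S_n) : rD x *m vf *m specht_gram = vf *m rS x *m specht_gram.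
Proof.
rewrite -[RHS]gram_class; congr (_ *m _ *m _).
rewrite -[LHS]/(in_factmod rad (val_factmod 1%:M *m rS x)).
by rewrite vfE mul1mx.
Qed.

Lemma hook_formJ (x : 'S_n) : rD x *m hook_form = hook_form *m (rD x^-1%g)^T.
Proof.
move: (rD x) (rD x^-1%g) (rS x) (rS x^-1%g) (vfJ x) (vfJ x^-1%g) (specht_gramJ x) gramT.
rewrite /hook_form; move: specht_gram => G X X' Y Y' XY XY' YG GT.
transitivity (vf *m (G *m Y'^T) *m vf^T).
  by rewrite -YG !mulmxA XY.
apply/trmx_inj; rewrite !(trmx_mul, trmxK) GT.
by rewrite !mulmxA XY'.
Qed.

Lemma hook_class_act A (x : 'S_n) : A *m const_mx 1 = 0 :> 'cV_q ->
  hook_class A *m rD x = hook_class (A *m perm_mx x).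
Proof.
move=> A0; rewrite -in_factmodJ ?in_setT //; congr in_factmod.
by rewrite -in_submodJ ?wedge_specht // [_ *m tabloid_repr _ _ _ _]wedge_act.
Qed.

Lemma hook_class_form A B :
  A *m const_mx 1 = 0 :> 'cV_q -> B *m const_mx 1 = 0 :> 'cV_q ->
  hook_class A *m hook_form *m (hook_class B)^T = wedge A *m (wedge B)^T.
Proof.
move=> A0 B0; rewrite -(wedge_val A0) -(wedge_val B0) /hook_form.
move: (gram_class (in_submod S (wedge A))) (gram_class (in_submod S (wedge B))).
rewrite -[in_factmod _ (_ _ (wedge A))]/(hook_class A).
rewrite -[in_factmod _ (_ _ (wedge B))]/(hook_class B).
move: (hook_class A) (hook_class B)
  (in_submod S (wedge A)) (in_submod S (wedge B)) => a b a' b'.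
move=> aG bG; rewrite [in RHS]trmx_mul [RHS]mulmxA -[a' *m v1 *m v1^T]mulmxA -/specht_gram.
move: specht_gram gramT aG bG => G GT aG bG.
rewrite !mulmxA aG.
have -> : a' *m G *m vf^T *m b^T = a' *m (b *m vf *m G)^T.
  by rewrite !trmx_mul GT !mulmxA.
by rewrite bG trmx_mul GT !mulmxA.
Qed.

Lemma hook_class_altf (C : 'cV[F]_d) : 
  exists c : 'I_#|{: tabloid}| -> F, forall A,
  hook_class A *m C = (altf c (fun i => hookR F (enum_val i : tabloid)) A)%:M.
Proof.
exists (fun i => (in_submod S 1%:M *m (in_factmod rad 1%:M *m C)) i 0) => A.
rewrite -wedge_altf /hook_class in_factmodE [in_submod S (wedge A)]in_submodE.
by rewrite !mulmxA.
Qed.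

(** The all-one row is orthogonal to every difference of points, so the
    determinant that gives the pairing with a polytabloid has a zero row. *)
Lemma hook_class_const A l : A *m const_mx 1 = 0 :> 'cV_q ->
  row l A = const_mx 1 -> hook_class A = 0.
Proof.
move=> A0 Al; apply/eqP; rewrite in_factmod_eq0 specht_rad.
apply/sub_kermxP; rewrite /specht_gram mulmxA wedge_val //.
have /submxP[X ->] : (v1 <= S)%MS by rewrite v1S.
rewrite trmx_mul mulmxA; suff -> : wedge A *m S^T = 0 by rewrite mul0mx.
apply/trmx_inj; rewrite trmx_mul trmxK trmx0; apply/sub_kermxP.
apply: specht_sub => s; apply/sub_kermxP/trmx_inj; rewrite trmx_mul trmx0 trmxK.
rewrite -wedge_act trmx_mul tabloid_repr_tr mulmxA wedge_act -polytabloid_wedge.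
rewrite polytabloid_pairing (expand_det_row _ l) big1 ?mulr0 ?raddf0 // => j _.
have Bl x : (A *m perm_mx s^-1%g) l x = 1.
  have := congr1 (fun v => (v *m perm_mx s^-1%g) 0 x) Al.
  by rewrite -row_mul mxE => ->; rewrite -col_permE !mxE.
move: (A *m perm_mx _) Bl => B Bl; rewrite (_ : (B *m _) l j = 0) ?mul0r //.
rewrite -[B *m _]trmxK trmx_mul trmxK mxE mul_hook_diff [B^T _ _]mxE.
by rewrite [B^T _ _]mxE !Bl subrr.
Qed.

End HookSimple.

(** * Points arranged in blocks *)

Lemma mulmx_perm_val (F : fieldType) k n (A : 'M[F]_(k, n)) (s : 'S_n) i x :
  (A *m perm_mx s) i (s x) = A i x.
Proof. by rewrite -[s in perm_mx s]invgK -col_permE mxE permK. Qed.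

Lemma mulmx_perm_eq (F : fieldType) k n (A B : 'M[F]_(k, n)) (s : 'S_n) :
  (forall i x, B i (s x) = A i x) -> A *m perm_mx s = B.
Proof.
move=> AB; apply/matrixP=> i x; rewrite -[x](permKV s).
by rewrite mulmx_perm_val AB.
Qed.

Section Wreath.
Variables (r N n : nat).
Local Notation p := r.+2.
Variables (pnt : 'I_N.+1 -> 'I_p -> 'I_n) (blk : 'I_n -> 'I_N.+1) (pos : 'I_n -> 'I_p).
Hypotheses (blkK : forall i j, blk (pnt i j) = i).
Hypotheses (posK : forall i j, pos (pnt i j) = j).
Hypotheses (pntK : forall x, pnt (blk x) (pos x) = x).

Lemma eq_pnt x i j : (x == pnt i j) = (blk x == i) && (pos x == j).
Proof.
apply/eqP/andP=> [-> | [/eqP <- /eqP <-]]; last by rewrite pntK.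
by rewrite blkK posK.
Qed.

Definition wr_fun (s : 'S_N.+1) (a : {ffun 'I_N.+1 -> 'I_p}) x :=
  pnt (s (blk x)) (pos x + a (blk x)).

Lemma wr_inj s a : injective (wr_fun s a).
Proof.
move=> x y e; rewrite -[x]pntK -[y]pntK.
have := congr1 blk e; rewrite !blkK => /perm_inj eb.
by have := congr1 pos e; rewrite !posK eb => /addIr ->.
Qed.

(** The element of the wreath product that sends block i to block s i with a
    rotation by a i. *)
Definition wr s a : 'S_n := perm (@wr_inj s a).

Lemma wrE s a i j : wr s a (pnt i j) = pnt (s i) (j + a i).
Proof. by rewrite permE /wr_fun blkK posK. Qed.

Lemma blk_wr s a x : blk (wr s a x) = s (blk x).
Proof. by rewrite permE /wr_fun blkK. Qed.

Lemma eq_on_points (s t : 'S_n) : (forall i j, s (pnt i j) = t (pnt i j)) -> s = t.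
Proof. by move=> st; apply/permP=> x; rewrite -[x]pntK. Qed.

Lemma wrM s a t b : (wr s a * wr t b)%g = wr (s * t)%g [ffun i => a i + b (s i)].
Proof.
by apply: eq_on_points => i j; rewrite permM !wrE permM ffunE addrA.
Qed.

Lemma wr1 : wr 1%g [ffun=> 0] = 1%g.
Proof. by apply: eq_on_points => i j; rewrite wrE !perm1 ffunE addr0. Qed.

Lemma wr_injective s a t b : wr s a = wr t b -> s = t /\ a = b.
Proof.
move=> e; have eij i : pnt (s i) (0 + a i) = pnt (t i) (0 + b i).
  by rewrite -!wrE e.
split; first by apply/permP=> i; have := congr1 blk (eij i); rewrite !blkK.
by apply/ffunP=> i; have := congr1 pos (eij i); rewrite !posK !add0r.
Qed.

Definition block_rot (P : pred 'I_N.+1) : 'S_n :=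
  wr 1%g [ffun i => if P i then 1 else 0].

Lemma block_rotX P k : (block_rot P ^+ k)%g = wr 1%g [ffun i => if P i then k%:R else 0].
Proof.
elim: k => [|k IHk].
  by rewrite expg0 -wr1; congr wr; apply/ffunP=> i; rewrite !ffunE if_same.
rewrite expgSr IHk wrM mulg1; congr wr; apply/ffunP=> i; rewrite !ffunE perm1.
by case: ifP; rewrite ?addr0 ?natr1.
Qed.

Lemma block_rotXE P k i j :
  (block_rot P ^+ k)%g (pnt i j) = pnt i (j + if P i then k%:R else 0).
Proof. by rewrite block_rotX wrE perm1 ffunE. Qed.

Lemma block_rotE P i j : block_rot P (pnt i j) = pnt i (j + if P i then 1 else 0).
Proof. by rewrite wrE perm1 ffunE. Qed.

Lemma wr_commute_block_rot (s : 'S_N.+1) a (P : pred 'I_N.+1) :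
  (forall i, P (s i) = P i) -> commute (wr s a) (block_rot P).
Proof.
move=> Ps; rewrite /commute !wrM mulg1 mul1g; congr wr.
by apply/ffunP=> i; rewrite !ffunE perm1 Ps addrC.
Qed.

Lemma Zp_char : p%:R = 0 :> 'I_p.
Proof. by apply/val_inj; rewrite Zp_nat /= modnn. Qed.

Lemma block_rot_order P : (block_rot P ^+ p)%g = 1%g.
Proof.
apply: eq_on_points => i j; rewrite block_rotXE perm1 Zp_char if_same.
by rewrite addr0.
Qed.

End Wreath.

Section CyclicRows.
Variables (F : fieldType) (r n : nat).
Local Notation p := r.+2.

(** kappa 0 is left out: the other rows and the sum of all rows determine it. *)
Definition cyc_rows (kappa : 'I_p -> 'rV[F]_n) : 'M[F]_(r.+1, n) :=
  \matrix_l kappa (lift ord0 l).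

(** The companion matrix of 1 + X + ... + X^(p - 1). *)
Definition companion : 'M[F]_r.+1 :=
  \matrix_(i, j) (if i == ord_max then -1 else (j == i.+1 :> nat)%:R).

Lemma det_companion : ~~ odd r.+1 -> \det companion = 1.
Proof.
move=> odd_r; rewrite (expand_det_col _ ord0) (bigD1 ord_max) //= big1 => [|i ni].
  rewrite addr0 mxE eqxx /cofactor /= addn0 (_ : row' _ _ = 1%:M).
    by rewrite det1 mulr1 -exprS -signr_odd (negPf odd_r).
  apply/matrixP=> i j; rewrite !mxE eq_sym (negPf (neq_lift _ _)).
  by rewrite lift0 lift_max eqSS eq_sym.
by rewrite mxE (negPf ni) mul0r.
Qed.

(** Only the last row needs an argument: Z sends it to kappa 0, which is u minus
    the sum of the rows. *)
Lemma cyc_rows_mul (kappa : 'I_p -> 'rV[F]_n) (Z : 'M[F]_n) u :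
  (forall j, kappa j *m Z = kappa (j + 1)) -> \sum_j kappa j = u ->
  cyc_rows kappa *m Z
  = companion *m cyc_rows kappa + delta_mx ord_max 0 *m u.
Proof.
move=> kZ ku; apply/row_matrixP=> l.
have rowu : row l (delta_mx ord_max (0 : 'I_1) *m u) = (l == ord_max)%:R *: u.
  by apply/rowP=> x; rewrite !mxE big_ord1 !mxE eqxx andbT.
rewrite row_mul rowK kZ raddfD /= rowu row_mul mulmx_sum_row.
under eq_bigr do rewrite !mxE rowK.
have [-> | nl] := eqVneq l ord_max.
  rewrite scale1r (_ : lift _ _ + 1 = 0); last first.
    by apply/val_inj; rewrite /= /bump /= add1n addn1 modnn.
  rewrite /= -scaler_sumr scaleN1r -ku [X in _ + X]big_ord_recl addrC addrK.
  by congr kappa; apply/val_inj.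
rewrite mulr0n scale0r addr0.
have lr : (l.+1 < r.+1)%N.
  by rewrite ltnS ltn_neqAle -ltnS ltn_ord andbT; apply: nl.
rewrite (bigD1 (Ordinal lr)) //= eqxx scale1r big1 ?addr0.
  by congr kappa; apply/val_inj; rewrite /= /bump /= !add1n addn1 modn_small.
by move=> j; rewrite -val_eqE /= => /negPf->; rewrite scale0r.
Qed.

End CyclicRows.

(** On a family that z permutes cyclically, the trace of a matrix of rank one is
    a convolution. *)
Lemma trace_rank_one (F : fieldType) (r n : nat) (z : 'S_n)
    (kappa mu : 'I_r.+2 -> 'rV[F]_n) (xi : 'cV[F]_n) j :
  (z ^+ r.+2)%g = 1%g ->
  (forall j, kappa j *m perm_mx z = kappa (j + 1)) ->
  (forall j, mu j *m perm_mx z = mu (j + 1)) ->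
  kappa j *m trace_mx r.+1 z (xi *m mu 0)
  = \sum_i (kappa (j - i) *m xi) *m mu i.
Proof.
move=> zp kz muz.
have powZ (k : 'I_r.+2 -> 'rV[F]_n) a i : (forall j, k j *m perm_mx z = k (j + 1)) ->
    k a *m perm_mx (z ^+ i)%g = k (a + i%:R).
  move=> kk; elim: i => [|i IHi]; first by rewrite expg0 perm_mx1 mulmx1 addr0.
  by rewrite expgSr perm_mxM mulmxA IHi kk -addrA natr1.
rewrite /trace_mx mulmx_sumr; apply: eq_bigr => i _; rewrite !mulmxA.
have -> : kappa j *m perm_mx (z ^- i)%g = kappa (j - i).
  rewrite -{1}(subrK i j) -{2}[i]natr_Zp -powZ //.
  by rewrite -mulmxA -perm_mxM mulgV perm_mx1 mulmx1.
by rewrite -!mulmxA powZ // add0r natr_Zp.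
Qed.

Section PointVectors.
Variables (F : fieldType) (r N n : nat).
Local Notation p := r.+2.
Hypothesis charF : p \in [pchar F].
Hypotheses (pN : (p %| N)%N).
Variables (pnt : 'I_N.+1 -> 'I_p -> 'I_n) (blk : 'I_n -> 'I_N.+1) (pos : 'I_n -> 'I_p).
Hypotheses (blkK : forall i j, blk (pnt i j) = i).
Hypotheses (posK : forall i j, pos (pnt i j) = j).
Hypotheses (pntK : forall x, pnt (blk x) (pos x) = x).

Local Notation wr := (wr blkK posK pntK).
Local Notation rotP := (block_rot blkK posK pntK).
Local Notation c := (rotP (pred1 ord0)).
Local Notation z := (rotP (predC1 ord0)).

(** The basis row of the point of block i in position j.  Block ord0 is Y, and
    the other blocks form X. *)
Definition ev i j : 'rV[F]_n := delta_mx 0 (pnt i j).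

Lemma ev_wr i j s a : ev i j *m perm_mx (wr s a) = ev (s i) (j + a i).
Proof.
apply: mulmx_perm_eq => k x; rewrite !mxE -(wrE blkK posK pntK).
by rewrite (inj_eq perm_inj).
Qed.

Lemma ev_rot i j P : ev i j *m perm_mx (rotP P) = ev i (j + if P i then 1 else 0).
Proof. by rewrite ev_wr perm1 ffunE. Qed.

Lemma ev_sum i j : ev i j *m const_mx 1 = const_mx 1 :> 'cV_1.
Proof.
apply/matrixP=> a b; rewrite !mxE (bigD1 (pnt i j)) //= !mxE ord1 !eqxx mulr1.
by rewrite big1 ?addr0 // => x /negPf nx; rewrite !mxE nx andbF mul0r.
Qed.

(** The projection of rows to their coordinates in Y. *)
Definition restrY : 'M[F]_n := diag_mx (\row_x (blk x == ord0)%:R).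

Lemma ev_restrY i j : i != ord0 -> ev i j *m restrY = 0.
Proof.
move=> i0; apply/rowP=> x; rewrite mul_mx_diag !mxE eqxx /=.
by rewrite (eq_pnt blkK posK pntK); case: eqP => [->|]; rewrite ?(negPf i0) ?mulr0 ?mul0r.
Qed.

(** Its row space consists of the rows of sum zero that are supported on X. *)
Definition sumX : 'M[F]_n := kermx (row_mx (const_mx 1 : 'cV_n) restrY).

Lemma sumXP k (A : 'M[F]_(k, n)) :
  reflect (A *m const_mx 1 = 0 :> 'cV_k /\ A *m restrY = 0) (A <= sumX)%MS.
Proof.
apply: (iffP sub_kermxP); rewrite mul_mx_row.
  by move=> E; rewrite -row_mx0 in E; case/eq_row_mx: E.
by case=> -> ->; rewrite row_mx0.
Qed.

Lemma ev_diff_sumX i j i' j' : i != ord0 -> i' != ord0 ->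
  (ev i j - ev i' j' <= sumX)%MS.
Proof.
move=> i0 i'0; apply/sumXP; rewrite !mulmxBl !ev_sum subrr.
by rewrite !ev_restrY // subrr.
Qed.

Lemma sumX_c k (A : 'M[F]_(k, n)) : (A <= sumX)%MS -> A *m perm_mx c = A.
Proof.
case/sumXP=> _ AY; apply: mulmx_perm_eq => i x.
have AY0 y : blk y = ord0 -> A i y = 0.
  move=> y0; have /matrixP/(_ i y) := AY; rewrite mul_mx_diag !mxE y0 eqxx.
  by rewrite mulr1.
rewrite -[x](pntK x); have [x0 | x0] := eqVneq (blk x) ord0.
  by rewrite x0 -[c]expg1 block_rotXE !AY0 ?blkK.
by rewrite -[c]expg1 block_rotXE /= (negPf x0) addr0.
Qed.

Lemma sum_perm (s : 'S_n) : const_mx 1 = perm_mx s *m const_mx 1 :> 'cV[F]_n.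
Proof. by apply/matrixP=> i j; rewrite -row_permE !mxE. Qed.

Lemma restrY_rot P : perm_mx (rotP P) *m restrY = restrY *m perm_mx (rotP P).
Proof.
apply/esym/mulmx_perm_eq => x y; rewrite -row_permE /restrY !mxE.
by rewrite (inj_eq perm_inj) blk_wr perm1.
Qed.

Lemma sumX_rot k (A : 'M[F]_(k, n)) P :
  (A <= sumX)%MS -> (A *m perm_mx (rotP P) <= sumX)%MS.
Proof.
case/sumXP=> A1 AY; apply/sumXP; rewrite -mulmxA -sum_perm A1.
by rewrite -mulmxA restrY_rot mulmxA AY mul0mx.
Qed.

(** The indicator row of X. *)
Definition allX : 'rV[F]_n := \sum_(i | i != ord0) \sum_j ev i j.

Lemma natN0 : N%:R = 0 :> F.
Proof. by apply/eqP; rewrite -(dvdn_pcharf charF). Qed.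

Lemma allX_sumX : (allX <= sumX)%MS.
Proof.
apply/sumXP; rewrite !mulmx_suml; split.
  rewrite big1 // => i _; rewrite mulmx_suml.
  under eq_bigr do rewrite ev_sum.
  rewrite sumr_const card_ord -scaler_nat (pcharf0 charF).
  by rewrite scale0r.
by rewrite big1 // => i i0; rewrite mulmx_suml big1 // => j _; apply: ev_restrY.
Qed.

Lemma allX_z : allX *m perm_mx z = allX.
Proof.
rewrite mulmx_suml; apply: eq_bigr => i i0; rewrite mulmx_suml.
rewrite [RHS](reindex_inj (addIr 1)) /=; apply: eq_bigr => j _.
by rewrite ev_rot /= i0.
Qed.

(** The indicator row of the points of X in position j. *)
Definition layer j : 'rV[F]_n := \sum_(i | i != ord0) ev i j.

Lemma layer_z j : layer j *m perm_mx z = layer (j + 1).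
Proof.
by rewrite mulmx_suml; apply: eq_bigr => i i0; rewrite ev_rot /= i0.
Qed.

Lemma layer_sum : \sum_j layer j = allX.
Proof. by rewrite exchange_big. Qed.

Lemma layer_sumX j : (layer j <= sumX)%MS.
Proof.
apply/sumXP; rewrite !mulmx_suml; split.
  under eq_bigr do rewrite ev_sum.
  rewrite sumr_const (_ : #|_| = N) -?scaler_nat ?natN0 ?scale0r //.
  by rewrite cardC1 card_ord.
by rewrite big1 // => i i0; apply: ev_restrY.
Qed.

Definition step b j : 'rV[F]_n := ev b j - ev b (j - 1).

Lemma step_z b j : b != ord0 -> step b j *m perm_mx z = step b (j + 1).
Proof.
by move=> b0; rewrite mulmxBl !ev_rot /= b0 subrK /step addrK.
Qed.

Lemma step_sum b : \sum_j step b j = 0.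
Proof.
by rewrite sumrB [X in X - _](reindex_inj (addIr (- 1))) subrr.
Qed.

Lemma step_sumX b j : b != ord0 -> (step b j <= sumX)%MS.
Proof. by move=> b0; apply: ev_diff_sumX. Qed.

Definition layer_rows := cyc_rows layer.
Definition step_rows b := cyc_rows (step b).

Lemma cyc_rows_sub (kappa : 'I_p -> 'rV[F]_n) (K : 'M[F]_n) :
  (forall j, kappa j <= K)%MS -> (cyc_rows kappa <= K)%MS.
Proof. by move=> kK; apply/row_subP=> l; rewrite rowK. Qed.

Lemma layer_rows_sumX : (layer_rows <= sumX)%MS.
Proof. exact/cyc_rows_sub/layer_sumX. Qed.

Lemma step_rows_sumX b : b != ord0 -> (step_rows b <= sumX)%MS.
Proof. by move=> b0; apply: cyc_rows_sub => j; apply: step_sumX. Qed.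

Lemma layer_rows_z : layer_rows *m perm_mx z
  = companion F r *m layer_rows + delta_mx ord_max 0 *m allX.
Proof. by apply: cyc_rows_mul; [apply: layer_z | apply: layer_sum]. Qed.

Lemma step_rows_z b : b != ord0 -> step_rows b *m perm_mx z = companion F r *m step_rows b.
Proof.
move=> b0; rewrite (cyc_rows_mul (u := 0)) ?mulmx0 ?addr0 //.
  by move=> j; apply: step_z.
exact: step_sum.
Qed.

End PointVectors.

(** * Invariance of pairings *)

Section FixedVectors.
Variables (F : fieldType) (gT : finGroupType) (G : {group gT}) (d : nat).
Variables (rG : mx_representation F G d) (w : 'rV[F]_d).

Lemma repr_fixV g : g \in G -> w *m rG g = w -> w *m rG g^-1%g = w.
Proof. by move=> Gg wg; rewrite -{1}wg repr_mxK. Qed.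

Lemma repr_fixX g k : g \in G -> w *m rG g = w -> w *m rG (g ^+ k)%g = w.
Proof.
move=> Gg wg; elim: k => [|k IHk]; first by rewrite expg0 repr_mx1 mulmx1.
by rewrite expgSr repr_mxM ?groupX // mulmxA IHk.
Qed.

Lemma repr_fix_commute g h : g \in G -> h \in G -> commute g h ->
  w *m rG g = w -> w *m rG h *m rG g = w *m rG h.
Proof.
move=> Gg Gh gh wg; rewrite -mulmxA -repr_mxM // -gh repr_mxM //.
by rewrite mulmxA wg.
Qed.

End FixedVectors.

Section HookForm.
Variables (q m : nat) (F : fieldType).
Local Notation n := (q.+1 + m)%N.
Local Notation la := (hook n q.+1).
Local Notation rD := (simple_repr n la F).
Local Notation d := (\rank (cokermx (mx_rad (specht_repr n la F)))).
Local Notation omega := (@hook_class q m F).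

Hypothesis charF : q.+1 \in [pchar F].
Hypotheses (q1 : (1 < q)%N) (m0 : (0 < m)%N).

Definition dform (a b : 'rV[F]_d) : F := (a *m hook_form q m F *m b^T) 0 0.

Lemma dformC a b : dform a b = dform b a.
Proof.
have formT : (hook_form q m F)^T = hook_form q m F.
  by rewrite /hook_form /specht_gram !(trmx_mul, trmxK) !mulmxA.
rewrite /dform; move: (hook_form q m F) formT => G GT.
have -> : b *m G *m a^T = (a *m G *m b^T)^T.
  by rewrite !trmx_mul trmxK GT mulmxA.
by rewrite [RHS]mxE.
Qed.

Lemma dform_act a b (g : 'S_n) : dform (a *m rD g) b = dform a (b *m rD g^-1%g).
Proof.
rewrite /dform; congr (_ 0 0); rewrite trmx_mul.
move: (hook_formJ charF q1 m0 g); move: (rD g) (rD g^-1%g) => X Y XY.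
by rewrite -(mulmxA a) XY !mulmxA.
Qed.

Lemma dform_sum (J : finType) (P : pred J) (v : J -> 'rV_d) b :
  dform (\sum_(j | P j) v j) b = \sum_(j | P j) dform (v j) b.
Proof. by rewrite /dform !mulmx_suml summxE. Qed.

Lemma dform_altf (f : 'M[F]_d) (w : 'rV_d) :
  exists I : finType, exists c : I -> F, exists R : I -> 'M[F]_(n, q),
  forall A, dform (omega A *m f) w = altf c R A.
Proof.
have [c cE] := hook_class_altf (f *m (hook_form q m F *m w^T)).
exists 'I_#|{: tabloid n la}|, c, (fun i => hookR F (enum_val i)) => A.
have -> : dform (omega A *m f) w = (omega A *m (f *m (hook_form q m F *m w^T))) 0 0.
  by rewrite /dform; move: (hook_form q m F) => G; rewrite !mulmxA.
by rewrite cE mxE mulr1n.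
Qed.

End HookForm.

Lemma set_row_const0 (F : fieldType) k n l (A : 'M[F]_(k, n)) (v : 'rV_n) :
  A *m const_mx 1 = 0 :> 'cV_k -> v *m const_mx 1 = 0 :> 'cV_1 ->
  set_row A l v *m const_mx 1 = 0 :> 'cV_k.
Proof.
move=> A0 v0; rewrite set_row_mulmx A0 v0.
by apply/matrixP=> i j; rewrite !mxE if_same.
Qed.

Section HookPoints.
Variables (F : fieldType) (r N m : nat).
Local Notation p := r.+2.
Local Notation q := r.+1.
Local Notation n := (p + m)%N.
Local Notation la := (hook n p).
Local Notation rD := (simple_repr n la F).
Local Notation d := (\rank (cokermx (mx_rad (specht_repr n la F)))).
Local Notation omega := (@hook_class q m F).
Hypothesis charF : p \in [pchar F].
Hypotheses (r0 : (0 < r)%N) (m0 : (0 < m)%N) (pN : (p %| N)%N).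
Variables (pnt : 'I_N.+1 -> 'I_p -> 'I_n) (blk : 'I_n -> 'I_N.+1) (pos : 'I_n -> 'I_p).
Hypotheses (blkK : forall i j, blk (pnt i j) = i).
Hypotheses (posK : forall i j, pos (pnt i j) = j).
Hypotheses (pntK : forall x, pnt (blk x) (pos x) = x).
Variable b : 'I_N.+1.
Hypothesis b0 : b != ord0.

Local Notation wr := (wr blkK posK pntK).
Local Notation rotP := (block_rot blkK posK pntK).
Local Notation c := (rotP (pred1 ord0)).
Local Notation z := (rotP (predC1 ord0)).
Local Notation ev := (ev F pnt).
Local Notation allX := (allX F pnt).
Local Notation sumX := (sumX F blk).
Local Notation layer_rows := (layer_rows F pnt).
Local Notation step_rows := (step_rows F pnt).

Let dX : (layer_rows <= sumX)%MS := layer_rows_sumX charF pN blkK posK pntK.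
Let kX i : i != ord0 -> (step_rows i <= sumX)%MS :=
  @step_rows_sumX F r N n pnt blk pos blkK posK pntK i.
Let Xc := @sumX_c F r N n pnt blk pos blkK posK pntK.

Lemma odd_pred : ~~ odd r.+1.
Proof.
have [//|op] := even_prime (pcharf_prime charF); first by move=> E; case: E r0 => ->.
by have := op; rewrite -addn1 oddD addbT.
Qed.

Lemma det_companion_char : \det (companion F r) = 1.
Proof. exact: det_companion odd_pred. Qed.

Lemma sumX0 k (A : 'M[F]_(k, n)) : (A <= sumX)%MS -> A *m const_mx 1 = 0 :> 'cV_k.
Proof. by case/sumXP. Qed.

Lemma const_points : const_mx 1 = \sum_j ev ord0 j + allX.
Proof.
transitivity (\sum_i \sum_j ev i j); last by rewrite (bigD1 ord0).
apply/rowP=> x; rewrite summxE mxE (bigD1 (blk x)) //= summxE (bigD1 (pos x)) //=.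
rewrite !mxE (pntK x) !eqxx !big1 ?addr0 // => [i | j].
  move=> ni; rewrite summxE big1 // => j _; rewrite mxE (eq_pnt blkK posK pntK).
  by rewrite eq_sym in ni; rewrite (negPf ni) andbF.
move=> nj; rewrite mxE (eq_pnt blkK posK pntK).
by rewrite eq_sym in nj; rewrite (negPf nj) !andbF.
Qed.

(** The indicator row of Y is a trace over <c> of a row of sum zero; subtracting
    the point of the block b makes the sum zero, and costs p times that point,
    that is, nothing. *)
Lemma allY_trace :
  \sum_j ev ord0 j = \sum_(j < p) (ev ord0 0 - ev b 0) *m perm_mx (c ^+ j)%g.
Proof.
have -> : \sum_(j < p) (ev ord0 0 - ev b 0) *m perm_mx (c ^+ j)%g
    = \sum_j (ev ord0 j - ev b 0).
  apply: eq_bigr => j _; rewrite block_rotX mulmxBl !ev_wr !perm1 !ffunE /=.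
  by rewrite (negPf b0) natr_Zp add0r addr0.
rewrite sumrB sumr_const card_ord -scaler_nat (pcharf0 charF).
by rewrite scale0r subr0.
Qed.

Lemma dform_fixX (v w : 'rV[F]_d) (g : 'S_n) k : w *m rD g = w ->
  dform (v *m rD (g ^+ k)%g) w = dform v w.
Proof.
move=> wg; rewrite (dform_act charF r0 m0); congr dform.
exact: (@repr_fixV _ _ _ _ rD w _ (in_setT _) (@repr_fixX _ _ _ _ rD w g k (in_setT g) wg)).
Qed.

(** Modulo the all-one row, allX is the opposite of the indicator row of Y.  That
    row is a trace over <c>, and c fixes both w and the rows of A, so the p terms
    of the trace contribute equally. *)
Lemma dform_allX A l w : (A <= sumX)%MS -> w *m rD c = w ->
  dform (omega (set_row A l allX)) w = 0.
Proof.
move=> AX wc; have [I [cT [R E]]] := dform_altf (1%:M : 'M[F]_d) w.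
have {}E B : dform (omega B) w = altf cT R B by rewrite -E mulmx1.
have A0 := sumX0 AX.
have constE : altf cT R (set_row A l (const_mx 1)) = 0.
  rewrite -E (@hook_class_const _ _ _ charF _ _ _ l) ?row_set_row //.
  - by rewrite /dform !mul0mx mxE.
  apply: set_row_const0 => //.
  rewrite const_points allY_trace mulmxDl (sumX0 (allX_sumX charF blkK posK pntK)).
  rewrite addr0 mulmx_suml big1 // => j _.
  by rewrite -mulmxA -sum_perm mulmxBl !ev_sum subrr.
move: constE; rewrite const_points -[\sum_j _]scale1r altf_set_row_lin mul1r.
rewrite allY_trace altf_set_row_sum -E.
rewrite (eq_bigr (fun=> dform (omega (set_row A l (ev ord0 0 - ev b 0))) w)) => [|j _].
  by rewrite sumr_const card_ord -mulr_natr (pcharf0 charF) mulr0 add0r.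
have Ac : A *m perm_mx (c ^+ j)%g = A.
  elim: (nat_of_ord j) => [|i IHi]; first by rewrite expg0 perm_mx1 mulmx1.
  by rewrite expgSr perm_mxM mulmxA IHi Xc.
rewrite -{1}Ac -set_row_mulmx -E -hook_class_act ?dform_fixX //.
by apply: set_row_const0; rewrite // mulmxBl !ev_sum subrr.
Qed.

(** [layer_class] and [step_class] are the vectors v and t of the introduction. *)
Definition layer_class : 'rV[F]_d := omega layer_rows.
Definition step_class i : 'rV[F]_d := omega (step_rows i).

Lemma layer_rows0 : layer_rows *m const_mx 1 = 0 :> 'cV_q.
Proof. exact: sumX0 dX. Qed.

(** z acts on the layers by a row operation of determinant 1, up to a multiple
    of allX. *)
Lemma dform_layer_class_z w : w *m rD c = w ->
  dform (layer_class *m rD z) w = dform layer_class w.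
Proof.
move=> wc; have [I [cT [R E]]] := dform_altf (1%:M : 'M[F]_d) w.
have {}E B : dform (omega B) w = altf cT R B by rewrite -E mulmx1.
rewrite hook_class_act ?layer_rows0 // layer_rows_z E altf_add_row -[X in _ + X]E.
rewrite dform_allX // ?addr0 ?altf_mull ?det_companion_char ?mul1r ?E //.
exact: submx_trans (submxMl _ _) dX.
Qed.

Lemma dform_layer_class_zV w :
  w *m rD c = w -> dform (layer_class *m rD z^-1%g) w = dform layer_class w.
Proof.
move=> wc; have wK : w = w *m rD z *m rD z^-1%g by rewrite repr_mxK ?in_setT.
have wzc : w *m rD z *m rD c = w *m rD z.
  apply: (@repr_fix_commute _ _ _ _ rD w _ _ (in_setT _) (in_setT _) _ wc).
  by apply: (eq_on_points pntK) => i j; rewrite !permM !block_rotE addrAC.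
rewrite {1}wK -(dform_act charF r0 m0) (repr_mxKV rD (in_setT z)).
by rewrite -(dform_layer_class_z wzc) (dform_act charF r0 m0) -wK.
Qed.

Lemma step_class_z i : i != ord0 -> step_class i *m rD z = step_class i.
Proof.
move=> i0; rewrite hook_class_act ?(sumX0 (kX i0)) //.
rewrite step_rows_z // /step_class /hook_class; congr (in_factmod _ (in_submod _ _)).
by apply/rowP=> T; rewrite !mxE -mulmxA det_mulmx det_companion_char mul1r.
Qed.

Lemma step_class_c i : i != ord0 -> step_class i *m rD c = step_class i.
Proof.
by move=> i0; rewrite hook_class_act ?(sumX0 (kX i0)) // Xc ?kX.
Qed.

Lemma layer_class_c : layer_class *m rD c = layer_class.
Proof.
by rewrite hook_class_act ?(sumX0 dX) // Xc.
Qed.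

(** Let mu l be the difference of the points of the blocks j and i in position
    l.  The steps of the block j are those of the block i plus mu l - mu (l - 1),
    and the latter is the image of the steps of the block i under the trace of
    xi *m mu 0, where xi is 1 at the points of position 0 of both blocks.  Having
    the two blocks in xi makes mu l *m xi vanish, so the trace kills mu. *)
Lemma dform_step_class (f : 'M[F]_d) i j :
  i != ord0 -> j != ord0 -> f *m rD c = rD c *m f -> f *m rD z = rD z *m f ->
  dform (step_class i *m f) layer_class = dform (step_class j *m f) layer_class.
Proof.
move=> i0 j0 fc fz; have [-> // | nij] := eqVneq i j.
have [I [cT [R E]]] := dform_altf f layer_class.
pose mu l := ev j l - ev i l.
pose xi : 'cV[F]_n := \col_x ((x == pnt i 0) || (x == pnt j 0))%:R.
have evxi a l : ev a l *m xi = (((a == i) || (a == j)) && (l == 0))%:R%:M.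
  apply/matrixP=> a' b'; rewrite !ord1 -rowE mxE [RHS]mxE mulr1n mxE.
  by rewrite !(eq_pnt blkK posK pntK) blkK posK andb_orl.
have zp : (z ^+ p)%g = 1%g by apply: block_rot_order.
have muz l : mu l *m perm_mx z = mu (l + 1).
  by rewrite mulmxBl !ev_rot /= i0 j0.
have muxi l : mu l *m xi = 0.
  by rewrite mulmxBl !evxi !eqxx orbT /= subrr.
have kN l : step F pnt i l *m trace_mx q z (xi *m mu 0) = mu l - mu (l - 1).
  rewrite trace_rank_one // => [|l']; last exact: step_z.
  have kxi l' : step F pnt i l' *m xi = ((l' == 0)%:R - (l' == 1)%:R)%:M.
    by rewrite mulmxBl !evxi eqxx /= subr_eq0 -raddfB.
  under eq_bigr do rewrite kxi mul_scalar_mx scalerBl.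
  rewrite sumrB; congr (_ - _).
    rewrite (bigD1 l) //= subrr eqxx scale1r big1 ?addr0 // => l' nl.
    by rewrite subr_eq0 eq_sym (negPf nl) scale0r.
  rewrite (bigD1 (l - 1)) //= subKr eqxx scale1r big1 ?addr0 // => l' nl.
  by rewrite subr_eq addrC -subr_eq eq_sym (negPf nl) scale0r.
have muX l : (mu l <= sumX)%MS by apply: ev_diff_sumX.
have AN : step_rows i *m trace_mx q z (xi *m mu 0) = cyc_rows (fun l => mu l - mu (l - 1)).
  by apply/row_matrixP=> l; rewrite row_mul !rowK kN.
have jE : step_rows j = step_rows i + step_rows i *m trace_mx q z (xi *m mu 0).
  apply/row_matrixP=> l; rewrite raddfD /= AN // !rowK /mu /step.
  by apply/rowP=> x; rewrite !mxE; ring.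
have muN l : mu l *m trace_mx q z (xi *m mu 0) = 0.
  rewrite trace_rank_one // big1 // => l' _.
  by rewrite muxi mul0mx.
have fixz w : w *m rD c = w -> dform (w *m rD z) layer_class = dform w layer_class.
  by move=> wc; rewrite (dform_act charF r0 m0) dformC (dform_layer_class_zV wc) dformC.
have fixc A : (A <= sumX)%MS -> omega A *m f *m rD c = omega A *m f.
  move=> AX; rewrite -mulmxA fc mulmxA (hook_class_act _ (sumX0 AX)).
  by rewrite Xc.
rewrite /step_class !E jE; apply/esym.
apply: (@altf_homotopy F q n I cT R charF sumX z 0 zp _ _ _ _ _ _ _ (companion F r) ord_max).
- by rewrite mul0mx.
- exact: sumX_rot.
- move=> A AX; rewrite -!E -(hook_class_act _ (sumX0 AX)).
  by rewrite -mulmxA -fz mulmxA fixz ?fixc.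
- by move=> A l _; rewrite altf_set_row0.
- exact: submx_trans (submxMl _ _) (muX 0).
- by rewrite mul0mx.
- exact: det_companion_char.
- exact: kX.
- by rewrite step_rows_z // mulmx0 addr0.
rewrite AN; apply/row_matrixP=> l.
by rewrite row_mul rowK mulmxBl !muN subrr row0.
Qed.


(** A rotation by a changes the layer l by mu (l + 1) - mu l, where mu l adds up,
    over the blocks i, the a i points of the block i from position l on.  This
    is the image of the layers under the trace of xi *m mu 0, where xi is
    supported on a block i0 that is not rotated; hence xi does not see mu. *)
Let dform_layer_class_wr0 (a : {ffun 'I_N.+1 -> 'I_p}) i0 v :
  a ord0 = 0 -> i0 != ord0 -> a i0 = 0 -> \sum_i a i = 0 ->
  v *m rD c = v -> v *m rD z = v ->
  dform (layer_class *m rD (wr 1%g a)) v = dform layer_class v.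
Proof.
move=> a0 i00 ai0 suma vc vz.
have [I [cT [R E]]] := dform_altf (1%:M : 'M[F]_d) v.
have {}E B : dform (omega B) v = altf cT R B by rewrite -E mulmx1.
pose mu l := \sum_i \sum_(t < a i) ev i (l + t%:R).
pose xi : 'cV[F]_n := \col_x ((x == pnt i0 (-1))%:R - (x == pnt i0 0)%:R).
have evxi k l : ev k l *m xi
    = (((k == i0) && (l == -1))%:R - ((k == i0) && (l == 0))%:R)%:M.
  apply/matrixP=> a' b'; rewrite !ord1 -rowE mxE [RHS]mxE mulr1n mxE.
  by rewrite !(eq_pnt blkK posK pntK) blkK posK.
have zp : (z ^+ p)%g = 1%g by apply: block_rot_order.
have ai_neq0 i (t : 'I_(a i)) : (i != ord0) * (i != i0).
  by split; apply/eqP=> ei; case: t => t; rewrite ei ?a0 ?ai0.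
have muz l : mu l *m perm_mx z = mu (l + 1).
  rewrite mulmx_suml; apply: eq_bigr => i _; rewrite mulmx_suml.
  by apply: eq_bigr => t _; rewrite ev_rot /= (ai_neq0 i t) addrAC.
have muxi l : mu l *m xi = 0.
  rewrite mulmx_suml big1 // => i _; rewrite mulmx_suml big1 // => t _.
  by rewrite evxi (negPf (ai_neq0 i t).2) subrr raddf0.
have dxi l : layer F pnt l *m xi = ((l == -1)%:R - (l == 0)%:R)%:M.
  rewrite mulmx_suml (bigD1 i0) //= evxi eqxx big1 ?addr0 // => i /andP[_ /negPf ni].
  by rewrite evxi ni subrr raddf0.
have dN l : layer F pnt l *m trace_mx q z (xi *m mu 0) = mu (l + 1) - mu l.
  rewrite trace_rank_one // => [|l']; last exact: layer_z.
  under eq_bigr do rewrite dxi mul_scalar_mx scalerBl.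
  rewrite sumrB; congr (_ - _).
    rewrite (bigD1 (l + 1)) //= opprD addrA subrr add0r eqxx scale1r.
    rewrite big1 ?addr0 // => l' nl.
    by rewrite subr_eq addrC -subr_eq opprK eq_sym (negPf nl) scale0r.
  rewrite (bigD1 l) //= subrr eqxx scale1r big1 ?addr0 // => l' nl.
  by rewrite subr_eq0 eq_sym (negPf nl) scale0r.
have suma_nat : (\sum_i a i)%:R = 0 :> F.
  apply/eqP; rewrite -(dvdn_pcharf charF) /dvdn; apply/eqP.
  have := congr1 val suma; rewrite -(eq_bigr _ (fun i _ => natr_Zp (a i))).
  by rewrite -natr_sum Zp_nat.
have muX l : (mu l <= sumX)%MS.
  apply/sumXP; split; rewrite mulmx_suml.
    under eq_bigr => i _.
      rewrite mulmx_suml; under eq_bigr do rewrite ev_sum.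
      rewrite sumr_const card_ord -scaler_nat; over.
    by rewrite -scaler_suml -natr_sum suma_nat scale0r.
  rewrite big1 // => i _; rewrite mulmx_suml big1 // => t _.
  by rewrite (ev_restrY F blkK posK pntK) ?(ai_neq0 i t).
have AN : layer_rows *m trace_mx q z (xi *m mu 0) = cyc_rows (fun l => mu (l + 1) - mu l).
  by apply/row_matrixP=> l; rewrite row_mul !rowK dN.
have muN l : mu l *m trace_mx q z (xi *m mu 0) = 0.
  rewrite trace_rank_one // big1 // => l' _.
  by rewrite muxi mul0mx.
have mu_diff l : mu (l + 1) - mu l = \sum_(i | i != ord0) (ev i (l + a i) - ev i l).
  rewrite -sumrB (bigD1 ord0) //= a0 !big_ord0 subrr add0r; apply: eq_bigr => i _.
  rewrite -[in RHS](natr_Zp (a i)); elim: (nat_of_ord (a i)) => [|k IHk].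
    by rewrite !big_ord0 !subrr addr0 subrr.
  rewrite !big_ord_recr /= opprD addrACA IHk -[l + 1 + _]addrA nat1r.
  by rewrite addrC addrA subrK.
have dE : layer_rows *m perm_mx (wr 1%g a) =
    layer_rows + layer_rows *m trace_mx q z (xi *m mu 0).
  apply/row_matrixP=> l; rewrite raddfD /= AN row_mul !rowK mu_diff sumrB.
  rewrite addrC subrK mulmx_suml; apply: eq_bigr => i _.
  by rewrite ev_wr perm1.
rewrite /layer_class (hook_class_act _ layer_rows0) !E dE.
apply: (@altf_homotopy F q n I cT R charF sumX z allX zp _ _ _ _ _ _ _
  (companion F r) ord_max).
- exact: allX_z.
- exact: sumX_rot.
- move=> A AX; rewrite -!E -(hook_class_act _ (sumX0 AX)).
  by rewrite -[z]expg1 dform_fixX.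
- by move=> A l AX; rewrite -E dform_allX.
- exact: submx_trans (submxMl _ _) (muX 0).
- rewrite mulmxA mulmx_suml (_ : \sum_(i < _ | _) _ = 0) ?mul0mx //.
  rewrite big1 // => i _; rewrite mulmx_suml.
  under eq_bigr do rewrite evxi raddfB /=.
  rewrite sumrB; apply/eqP; rewrite subr_eq0; apply/eqP.
  rewrite (bigD1 (-1)) //= [RHS](bigD1 0) //= !eqxx !andbT.
  by congr (_ + _); rewrite !big1 // => l /negPf ->; rewrite andbF raddf0.
- exact: det_companion_char.
- exact: dX.
- exact: layer_rows_z.
rewrite AN; apply/row_matrixP=> l.
by rewrite row_mul rowK mulmxBl !muN subrr row0.
Qed.

Let wr1M (a a' : {ffun 'I_N.+1 -> 'I_p}) :
  wr 1%g [ffun i => a i + a' i] = (wr 1%g a * wr 1%g a')%g.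
Proof.
by rewrite wrM mulg1; congr wr; apply/ffunP=> i; rewrite !ffunE perm1.
Qed.

Hypothesis N3 : (3 <= N)%N.

(** A family of rotations of total 0 is a product of two such families, each of
    which leaves a block of X unrotated: the first one, a1, is supported on the two
    blocks i1 and i2, and the second one vanishes at i1.  A third block i3 is left
    fixed by a1. *)
Lemma dform_layer_class_wr (a : {ffun 'I_N.+1 -> 'I_p}) v :
  a ord0 = 0 -> \sum_i a i = 0 -> v *m rD c = v -> v *m rD z = v ->
  dform (layer_class *m rD (wr 1%g a)) v = dform layer_class v.
Proof.
move=> a0 suma vc vz.
have N1 : (1 < N.+1)%N by exact: ltnW (ltnW N3).
have N2 : (2 < N.+1)%N by exact: ltnW N3.
have N3' : (3 < N.+1)%N by exact: N3.
pose i1 := Ordinal N1; pose i2 := Ordinal N2; pose i3 := Ordinal N3'.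
pose a1 := [ffun i : 'I_N.+1 => if i == i1 then a i1 else if i == i2 then - a i1 else 0].
pose a2 := [ffun i => a i - a1 i].
have suma1 : \sum_i a1 i = 0.
  rewrite (bigD1 i1) //= (bigD1 i2) //= !ffunE !eqxx /= big1 ?addr0 ?addrN //.
  by move=> i /andP[/negPf i1' /negPf i2']; rewrite ffunE i1' i2'.
have -> : a = [ffun i => a1 i + a2 i].
  by apply/ffunP=> i; rewrite [RHS]ffunE [a2 i]ffunE addrC subrK.
have commE P (w : 'rV_d) : w *m rD (rotP P) = w ->
    w *m rD (wr 1%g a2)^-1%g *m rD (rotP P) = w *m rD (wr 1%g a2)^-1%g.
  have rotS i : P ((1%g : 'S_N.+1) i) = P i by rewrite perm1.
  move=> wP; have gh := commuteV (commute_sym (wr_commute_block_rot blkK posK pntK a2 rotS)).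
  exact: (@repr_fix_commute _ _ _ _ rD w (rotP P) _ (in_setT _) (in_setT _) gh wP).
rewrite wr1M repr_mxM ?in_setT // mulmxA (dform_act charF r0 m0).
rewrite (@dform_layer_class_wr0 a1 i3) ?commE //; last first.
- by rewrite ffunE.
- by rewrite ffunE.
rewrite -(dform_act charF r0 m0) (@dform_layer_class_wr0 a2 i1) //.
- by rewrite !ffunE a0 subrr.
- by rewrite !ffunE eqxx subrr.
by under eq_bigr do rewrite ffunE; rewrite sumrB suma suma1 subrr.
Qed.

End HookPoints.

Lemma wedge_gram (F : fieldType) (q m : nat) A (M : 'M[F]_q) (s : 'S_(q.+1 + m)) :
  let B := M *m (hook_diff q m F *m perm_mx s) in
  wedge A *m (wedge B)^T = (q`!%:R * \det (A *m B^T))%:M.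
Proof.
move=> B; rewrite /B.
have -> : wedge (M *m (hook_diff q m F *m perm_mx s))
    = \det M *: wedge (hook_diff q m F *m perm_mx s).
  by apply/rowP=> T; rewrite !mxE -mulmxA det_mulmx.
rewrite linearZ /= -scalemxAr -wedge_act -polytabloid_wedge trmx_mul.
rewrite tabloid_repr_tr mulmxA wedge_act polytabloid_pairing scale_scalar_mx.
congr (_%:M); rewrite mulrCA; congr (_ * _).
by rewrite !trmx_mul tr_perm_mx !mulmxA det_mulmx det_tr mulrC.
Qed.

Lemma lift_sub1 r (l : 'I_r.+1) : lift ord0 l - 1 = widen_ord (leqnSn r.+1) l.
Proof.
suff -> : lift ord0 l = widen_ord (leqnSn r.+1) l + 1 by rewrite addrK.
apply/val_inj; rewrite /= /bump /= add1n addn1 modn_small //.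
by rewrite ltnS.
Qed.

Section HookGram.
Variables (F : fieldType) (r N m : nat).
Local Notation p := r.+2.
Local Notation q := r.+1.
Local Notation n := (p + m)%N.
Local Notation la := (hook n p).
Local Notation omega := (@hook_class q m F).
Hypothesis charF : p \in [pchar F].
Hypotheses (r0 : (0 < r)%N) (m0 : (0 < m)%N).
Variables (pnt : 'I_N.+1 -> 'I_p -> 'I_n) (blk : 'I_n -> 'I_N.+1) (pos : 'I_n -> 'I_p).
Hypotheses (blkK : forall i j, blk (pnt i j) = i).
Hypotheses (posK : forall i j, pos (pnt i j) = j).
Hypotheses (pntK : forall x, pnt (blk x) (pos x) = x).

(** The steps of the block b are a combination, with unitriangular matrix M, of
    the differences between the points of b and its first point.  The Gram
    determinant of A and the steps is that of a unitriangular matrix, so the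
    pairing is q`!. *)
Lemma dform_step_class_neq0 b (A : 'M[F]_(q, n)) :
  b != ord0 -> A *m const_mx 1 = 0 :> 'cV_q ->
  (forall l j, A l (pnt b j) = (j == lift ord0 l)%:R) ->
  dform (omega A) (step_class F pnt b) != 0.
Proof.
move=> b0 A0 Ab.
have k0 : step_rows F pnt b *m const_mx 1 = 0 :> 'cV_q.
  exact: sumX0 (step_rows_sumX F blkK posK pntK b0).
have inj_pt : injective (pnt b) by move=> i j e; rewrite -[i](posK b) e posK.
have [s sE] := perm_extension (@lshift_inj p m) inj_pt.
pose M : 'M[F]_q := \matrix_(l, l') ((l' == l)%:R - (l'.+1 == l :> nat)%:R).
have kE : step_rows F pnt b = M *m (hook_diff q m F *m perm_mx s).
  have hE : hook_diff q m F *m perm_mx s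
      = \matrix_l (ev F pnt b (lift ord0 l) - ev F pnt b 0).
    apply: mulmx_perm_eq => l x; rewrite !mxE /= -!sE !(inj_eq perm_inj).
    by rewrite ?eqxx.
  rewrite hE; apply/row_matrixP=> l; rewrite rowK row_mul mulmx_sum_row.
  under eq_bigr do rewrite !mxE rowK scalerBl.
  rewrite sumrB (bigD1 l) //= eqxx scale1r [X in _ + X - _]big1 ?addr0; last first.
    by move=> l' /negPf->; rewrite scale0r.
  rewrite /step lift_sub1; case: (posnP l) => [l0 | l0].
    rewrite big1 ?subr0; last by move=> l' _; rewrite l0 scale0r.
    by congr (_ - ev _ _ _ _); apply/val_inj; rewrite /= l0.
  have lq : (l.-1 < q)%N by apply: leq_ltn_trans (leq_pred _) (ltn_ord l).
  rewrite (bigD1 (Ordinal lq)) //= prednK // eqxx scale1r big1 ?addr0; last first.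
    move=> l'; rewrite -val_eqE /= => nl; case: eqP => [e|]; rewrite ?scale0r //.
    by case/negP: nl; rewrite -e.
  rewrite opprB addrA subrK; congr (_ - ev _ _ _ _); apply/val_inj => /=.
  by rewrite /bump /= add1n prednK.
rewrite /dform /step_class (hook_class_form charF r0 m0 A0 k0) {1}kE wedge_gram -kE.
rewrite mxE mulr1n mulf_neq0 ?(hook_fact_neq0 charF) //.
have evA l j : (ev F pnt b j *m A^T) 0 l = (j == lift ord0 l)%:R.
  by rewrite -rowE !mxE Ab.
have kA l l' : (step_rows F pnt b *m A^T) l l'
    = (l == l')%:R - (l == l'.+1 :> nat)%:R.
  have -> : (step_rows F pnt b *m A^T) l l' = (step F pnt b (lift ord0 l) *m A^T) 0 l'.
    transitivity ((row l (step_rows F pnt b) *m A^T) 0 l'); last by rewrite rowK.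
    by rewrite -row_mul [RHS]mxE.
  by rewrite /step lift_sub1 mulmxBl mxE evA [X in _ + X]mxE evA (inj_eq lift_inj).
rewrite -det_tr trmx_mul trmxK det_trig.
  rewrite big1 ?oner_eq0 // => l _; rewrite kA eqxx.
  by rewrite (ltn_eqF (ltnSn l)) subr0.
apply/is_trig_mxP=> l l' ll'; rewrite kA -val_eqE /= ltn_eqF //.
by rewrite ltn_eqF ?subrr // ltnW.
Qed.
End HookGram.

(** * Subgroups contained in a conjugate of Q *)

Section CosetTest.
Variables (F : fieldType) (r N m : nat).
Local Notation p := r.+2.
Local Notation q := r.+1.
Local Notation n := (p + m)%N.
Local Notation la := (hook n p).
Local Notation rD := (simple_repr n la F).
Local Notation d := (\rank (cokermx (mx_rad (specht_repr n la F)))).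
Local Notation omega := (@hook_class q m F).
Hypothesis charF : p \in [pchar F].
Hypotheses (r0 : (0 < r)%N) (m0 : (0 < m)%N) (pN : (p %| N)%N) (N3 : (3 <= N)%N).
Variables (pnt : 'I_N.+1 -> 'I_p -> 'I_n) (blk : 'I_n -> 'I_N.+1) (pos : 'I_n -> 'I_p).
Hypotheses (blkK : forall i j, blk (pnt i j) = i).
Hypotheses (posK : forall i j, pos (pnt i j) = j).
Hypotheses (pntK : forall x, pnt (blk x) (pos x) = x).
Variables (Q : {group 'S_n}) (f : {set 'S_n} -> 'M[F]_d).
Hypothesis sumf : \sum_(A in rcosets Q [set: 'S_n]) f A = 1%:M.
Hypothesis f_act : forall A g, A \in rcosets Q [set: 'S_n] -> g \in [set: 'S_n] ->
  f A *m rD g = rD g *m f (A :* g)%g.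

Local Notation wr := (wr blkK posK pntK).
Local Notation rotP := (block_rot blkK posK pntK).
Local Notation c := (rotP (pred1 ord0)).
Local Notation z := (rotP (predC1 ord0)).
Local Notation step_class := (step_class F pnt).
Local Notation layer_class := (layer_class F pnt).
Local Notation S0 := (rcosets Q [set: 'S_n]).

Lemma coset_form_act (t v : 'rV[F]_d) A g : A \in S0 ->
  dform (t *m f (A :* g)%g) v
  = dform (t *m rD g^-1%g *m f A) (v *m rD g^-1%g).
Proof.
move=> AS; have fA : f (A :* g)%g = rD g^-1%g *m f A *m rD g.
  rewrite -[rD g^-1%g *m _ *m _]mulmxA f_act ?in_setT // mulmxA -repr_mxM ?in_setT //.
  by rewrite mulVg repr_mx1 mul1mx.
rewrite fA (mulmxA t (rD g^-1%g *m f A) (rD g)) (mulmxA t (rD g^-1%g) (f A)).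
exact: (dform_act charF r0 m0).
Qed.

Lemma coset_form_sum (t v : 'rV[F]_d) :
  \sum_(A in S0) dform (t *m f A) v = dform t v.
Proof. by rewrite -dform_sum -mulmx_sumr sumf mulmx1. Qed.

Lemma rcosets_acts (E : {group 'S_n}) : [acts E, on S0 | 'Rs].
Proof.
apply/subsetP=> g _; rewrite !inE /=; apply/subsetP=> A /rcosetsP[x _ ->].
by rewrite inE /= rcosetE -rcosetM; apply/rcosetsP; exists (x * g)%g; rewrite ?in_setT.
Qed.

(** The stabilizer of the coset Q :* x is Q :^ x. *)
Lemma fixed_coset (E : {group 'S_n}) (S : {set {set 'S_n}}) phi : S \subset S0 ->
  \sum_(A in 'Fix_(S | 'Rs)(E)) phi A != 0 :> F ->
  exists x, (E \subset Q :^ x)%g.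
Proof.
move=> SS0 nz; have [A AF] : exists A, A \in 'Fix_(S | 'Rs)(E).
  apply/set0Pn; apply: contraNneq nz => ->; rewrite big1 // => A.
  by rewrite inE.
have [AS /afixP fixA] := setIP AF; have /rcosetsP[x _ Ax] := subsetP SS0 A AS.
exists x; apply: rcoset_fixed_conj => h Eh; rewrite -Ax.
by have := fixA h Eh; rewrite /= rcosetE.
Qed.

(** The terms < t f_A, v > are constant on the E-orbits of cosets, so the sum,
    which is not 0, is carried by the fixed cosets. *)
Theorem fixed_pair_conj (E : {group 'S_n}) (t v : 'rV[F]_d) :
  (p.-group E)%g ->
  (forall g, g \in E -> t *m rD g = t /\ v *m rD g = v) ->
  dform t v != 0 -> exists x, (E \subset Q :^ x)%g.
Proof.
move=> pE fixE nz; apply: (@fixed_coset E S0 (fun A => dform (t *m f A) v)) => //.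
rewrite -(sum_fixed_points charF pE (rcosets_acts E)) ?coset_form_sum //.
move=> A h AS Eh; rewrite /= rcosetE coset_form_act //.
by have [-> ->] := fixE _ (groupVr Eh).
Qed.

(** A rotation of the block s b alone has the same effect on its steps as a
    power of z, and z fixes the class. *)
Lemma step_class_wr b (s : 'S_N.+1) a : b != ord0 -> s ord0 = ord0 ->
  step_class b *m rD (wr s a) = step_class (s b).
Proof.
move=> b0 s0; have sb0 : s b != ord0 by rewrite -s0 (inj_eq perm_inj).
have kX i (i0 : i != ord0) := sumX0 (step_rows_sumX F blkK posK pntK i0).
rewrite hook_class_act ?kX //.
have -> : step_rows F pnt b *m perm_mx (wr s a)
    = step_rows F pnt (s b) *m perm_mx (z ^+ a b)%g.
  apply/row_matrixP=> l; rewrite !row_mul !rowK /step !mulmxBl block_rotX !ev_wr.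
  by rewrite !perm1 !ffunE /= sb0 natr_Zp.
rewrite -hook_class_act ?kX //.
exact: (@repr_fixX _ _ _ _ rD (step_class (s b)) z _ (in_setT _)
  (step_class_z charF r0 blkK posK pntK sb0)).
Qed.

(** Permuting the blocks of X only permutes the terms of each layer. *)
Lemma layer_class_wr (s : 'S_N.+1) a : s ord0 = ord0 ->
  layer_class *m rD (wr s a)
  = layer_class *m rD (wr 1%g [ffun i => if i == ord0 then 0 else a (s^-1%g i)]).
Proof.
move=> s0; have dX := sumX0 (layer_rows_sumX charF pN blkK posK pntK).
apply: etrans (hook_class_act _ dX) (etrans _ (esym (hook_class_act _ dX))).
congr hook_class.
apply/row_matrixP=> l; rewrite !row_mul !rowK !mulmx_suml.
rewrite [RHS](reindex_inj (@perm_inj _ s)) /=.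
apply: eq_big => [i | i i0]; first by rewrite -[in RHS]s0 (inj_eq perm_inj).
rewrite !ev_wr perm1 ffunE -{1}s0 (inj_eq perm_inj) (negPf i0).
by rewrite permK.
Qed.

(** The sum of phi is restricted in three stages.  The group <c> fixes t and v, so
    the cosets fixed by c carry the sum.  For such a coset A, f_A commutes with
    c, so that t f_A is fixed by c, and by [dform_layer_class_zV] the value phi A
    does not change under z, although z does not fix v.  For a coset fixed by c
    and z, t f_A is fixed by both, and the two invariance results apply to all
    elements of H. *)
Theorem wreath_pair_conj (H : {group 'S_n}) : (p.-group H)%g ->
  (forall h, h \in H -> exists (s : 'S_N.+1) a,
    [/\ h = wr s a, s ord0 = ord0 & \sum_(i | i != ord0) a i = 0]) ->
  exists x, (H \subset Q :^ x)%g.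
Proof.
move=> pH HW.
have pcyc P : (p.-group <[rotP P]>)%g.
  rewrite /pgroup -orderE; apply: (@pnat_dvd _ p); last exact: pnat_id (pcharf_prime charF).
  by rewrite order_dvdn block_rot_order.
have N1 : (1 < N.+1)%N by exact: ltnW (ltnW N3).
pose b := Ordinal N1; have b0 : b != ord0 by [].
pose phi A := dform (step_class b *m f A) layer_class.
have Hc h : h \in H -> commute h c /\ commute h z.
  move=> /HW[s [a [-> s0 _]]]; split; apply: wr_commute_block_rot => i /=;
  by rewrite -{1}s0 (inj_eq perm_inj).
have cz : commute c z by apply: wr_commute_block_rot => i; rewrite perm1.
pose S1 := 'Fix_(S0 | 'Rs)(<[c]>); pose S2 := 'Fix_(S1 | 'Rs)(<[z]>).
have S1P A : A \in S1 -> A \in S0 /\ (A :* c)%g = A.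
  by case/setIP=> AS /afixP/(_ c (cycle_id c)); rewrite /= rcosetE.
have S2P A : A \in S2 -> A \in S1 /\ (A :* z)%g = A.
  by case/setIP=> AS /afixP/(_ z (cycle_id z)); rewrite /= rcosetE.
have act1 : [acts <[z]>, on S1 | 'Rs].
  rewrite actsI ?rcosets_acts // acts_fix_norm // cents_norm //.
  by rewrite cycle_subG /= cent_cycle; apply/cent1P.
have act2 : [acts H, on S2 | 'Rs].
  have HN P : (forall h, h \in H -> commute h (rotP P)) ->
      [acts H, on 'Fix_('Rs)(<[rotP P]>) | 'Rs].
    move=> comm; apply: acts_fix_norm; apply: cents_norm; apply/subsetP=> h Hh.
    by rewrite cent_cycle; apply/cent1P; apply: comm.
  rewrite !actsI ?rcosets_acts ?HN // => h /Hc[]; by [].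
have sS1 : S1 \subset S0 by apply: subsetIl.
have sS2 : S2 \subset S0 by apply: subset_trans (subsetIl _ _) sS1.
apply: (@fixed_coset H S2 phi) => //.
have tc : step_class b *m rD c^-1%g = step_class b.
  apply: (@repr_fixV _ _ _ _ rD (step_class b) c (in_setT _)).
  exact: (step_class_c F blkK posK pntK b0).
have tz : step_class b *m rD z^-1%g = step_class b.
  apply: (@repr_fixV _ _ _ _ rD (step_class b) z (in_setT _)).
  exact: (step_class_z charF r0 blkK posK pntK b0).
have dc : layer_class *m rD c^-1%g = layer_class.
  apply: (@repr_fixV _ _ _ _ rD layer_class c (in_setT _)).
  exact: (layer_class_c charF pN blkK posK pntK).
have fcomm A g : A \in S0 -> (A :* g)%g = A -> f A *m rD g = rD g *m f A.
  by move=> AS Ag; rewrite f_act ?in_setT // Ag.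
have comm_fix A g (t : 'rV_d) : f A *m rD g = rD g *m f A ->
    t *m rD g = t -> t *m f A *m rD g = t *m f A.
  move=> fg tg; rewrite -(mulmxA t (f A) (rD g)) fg (mulmxA t (rD g) (f A)).
  by rewrite tg.
have phic A : A \in S0 -> phi (A :* c)%g = phi A.
  by move=> AS; rewrite /phi coset_form_act // tc dc.
have phiz A : A \in S1 -> phi (A :* z)%g = phi A.
  case/S1P=> AS Ac; rewrite /phi coset_form_act // tz dformC.
  rewrite (dform_layer_class_zV charF r0 m0 pN b0); first by rewrite dformC.
  apply: (comm_fix A c (step_class b) (fcomm A c AS Ac)).
  exact: (step_class_c F blkK posK pntK b0).
have phi_cycle (S : {set {set 'S_n}}) g : [acts <[g]>, on S | 'Rs] ->
    (forall A, A \in S -> phi (A :* g)%g = phi A) ->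
    forall A h, A \in S -> h \in <[g]>%g -> phi ('Rs%act A h) = phi A.
  move=> actg phig A h AS /cycleP[k ->]; rewrite /= rcosetE.
  elim: k => [|k IHk]; first by rewrite expg0 rcoset1.
  rewrite expgSr rcosetM phig //.
  have := acts_act actg (mem_cycle g k) A; rewrite /= rcosetE => ->.
  exact: AS.
rewrite -(sum_fixed_points charF pH act2).
  rewrite -(sum_fixed_points charF (pcyc _) act1 (phi_cycle _ _ act1 phiz)).
  rewrite -(sum_fixed_points charF (pcyc _) (rcosets_acts _)); last first.
    by apply: phi_cycle => //; apply: rcosets_acts.
  rewrite coset_form_sum dformC.
  apply: (dform_step_class_neq0 charF r0 m0 blkK posK pntK b0).
    exact: (layer_rows0 charF pN blkK posK pntK).
  move=> l j; rewrite mxE /layer summxE (bigD1 b) //= big1 ?addr0.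
    by rewrite mxE eqxx (eq_pnt blkK posK pntK) blkK posK eqxx.
  move=> i /andP[_ ni]; rewrite mxE (eq_pnt blkK posK pntK) blkK.
  by rewrite eq_sym (negPf ni) andbF.
move=> A h AS2 Hh; have [AS1 Az] := S2P A AS2; have [AS Ac] := S1P A AS1.
rewrite /= rcosetE /phi coset_form_act //.
have [s [a [-> s0 suma]]] := HW _ (groupVr Hh).
have sb0 : s b != ord0 by rewrite -s0 (inj_eq perm_inj).
have fAc := fcomm A c AS Ac; have fAz := fcomm A z AS Az.
rewrite (step_class_wr a b0 s0) (layer_class_wr a s0) dformC.
have vc := comm_fix A c (step_class (s b)) fAc (step_class_c F blkK posK pntK sb0).
have vz := comm_fix A z (step_class (s b)) fAz (step_class_z charF r0 blkK posK pntK sb0).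
pose a' := [ffun i => if i == ord0 then 0 else a (s^-1%g i)].
have a'0 : a' ord0 = 0 by rewrite ffunE eqxx.
have suma' : \sum_i a' i = 0.
  rewrite (bigD1 ord0) //= a'0 add0r -[RHS]suma [LHS](reindex_inj (@perm_inj _ s)) /=.
  apply: eq_big => [i | i i0]; first by rewrite -[in LHS]s0 (inj_eq perm_inj).
  by rewrite ffunE (negPf i0) permK.
rewrite (dform_layer_class_wr charF r0 m0 pN b0 N3 a'0 suma' vc vz) dformC.
exact: (dform_step_class charF r0 m0 pN b0 sb0 b0 fAc fAz).
Qed.

End CosetTest.

(** The conditions make H a Sylow p-subgroup of a conjugate of Q. *)
Lemma pgroup_conj_into (gT : finGroupType) (p : nat) (Q H E : {group gT}) (x y : gT) :
  (p.-group H)%g -> (p.-group E)%g ->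
  (H \subset Q :^ x)%g -> (E \subset Q :^ y)%g -> (#|Q|`_p <= #|H|)%N ->
  exists g, (E :^ g \subset H)%g.
Proof.
move=> pH pE sHQ sEQ leQH.
have sylHQ : (p.-Sylow(Q :^ x) H)%g.
  rewrite pHallE sHQ /= eqn_leq cardJg leQH andbT -(part_pnat_id pH).
  by rewrite -(cardJg Q x) dvdn_leq ?part_gt0 // partn_dvd ?cardSg ?cardG_gt0.
have sE' : (E :^ (y^-1 * x) \subset Q :^ x)%g by rewrite conjsgM conjSg sub_conjgV.
have pE' : (p.-group (E :^ (y^-1 * x)))%g by rewrite pgroupJ.
have [u _ Eu] := Sylow_Jsub sylHQ sE' pE'.
by exists (y^-1 * x * u)%g; rewrite conjsgM.
Qed.

(** * Group orders and supports *)

(** In Legendre's formula, the first term is M and the others are those of M`!. *)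
Lemma logn_fact_mul p M : prime p -> logn p (M * p)`! = (M + logn p M`!)%N.
Proof.
move=> pr; have p1 := prime_gt1 pr; rewrite !logn_fact //.
case: M => [|M]; first by rewrite mul0n !big_geq.
have Mp : (1 <= M.+1 * p)%N by rewrite muln_gt0 (prime_gt0 pr).
rewrite big_ltn // expn1 mulnK ?(prime_gt0 pr) //; congr (_ + _)%N.
rewrite big_add1 /= (big_cat_nat (n := M.+2)) //=; last first.
  by rewrite mulSn -addn2 addnC leq_add // leq_pmulr // prime_gt0.
have E i : (M.+1 * p %/ p ^ i.+1 = M.+1 %/ p ^ i)%N.
  by rewrite expnSr divnMr // prime_gt0.
under eq_bigr do rewrite E; under [X in (_ + X)%N]eq_bigr do rewrite E.
rewrite [X in (_ + X)%N]big_nat_cond [X in (_ + X)%N]big1 ?addn0 // => i.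
rewrite andbT => /andP[Mi _]; rewrite divn_small //.
by apply: ltn_trans (ltn_expl i p1); apply: leq_trans Mi.
Qed.

Section MovedPoints.
Variable T : finType.
Implicit Types s g : {perm T}.

Definition moved s : {set T} := [set x | s x != x].

Lemma moved_conj s g : moved (s ^ g)%g = g @: moved s.
Proof.
apply/setP=> x; rewrite inE conjgE !permM -[x in RHS](permKV g) mem_imset ?inE.
  by rewrite -[x in LHS](permKV g) permK (inj_eq perm_inj).
exact: perm_inj.
Qed.

End MovedPoints.

Section WreathGroup.
Variables (r N n : nat).
Local Notation p := r.+2.
Variables (pnt : 'I_N.+1 -> 'I_p -> 'I_n) (blk : 'I_n -> 'I_N.+1) (pos : 'I_n -> 'I_p).
Hypotheses (blkK : forall i j, blk (pnt i j) = i).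
Hypotheses (posK : forall i j, pos (pnt i j) = j).
Hypotheses (pntK : forall x, pnt (blk x) (pos x) = x).
Hypothesis N0 : (0 < N)%N.

Local Notation wr := (wr blkK posK pntK).
Local Notation rotP := (block_rot blkK posK pntK).

(** The entry at ord0 is free: the block Y may be rotated by any amount. *)
Definition zero_sum : {set {ffun 'I_N.+1 -> 'I_p}} :=
  [set a : {ffun 'I_N.+1 -> 'I_p} | \sum_(i | i != ord0) a i == 0].

Lemma card_zero_sum : #|zero_sum| = (p ^ N)%N.
Proof.
pose b : 'I_N.+1 := Ordinal (N0 : (1 < N.+1)%N).
have b0 : b != ord0 by [].
(* Changing the entry at b gives every function from a unique one of sum 0. *)
pose g (u : 'I_p * {ffun 'I_N.+1 -> 'I_p}) : {ffun 'I_N.+1 -> 'I_p} :=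
  [ffun i => u.2 i + if i == b then u.1 else 0].
have sumg u : \sum_(i | i != ord0) g u i = \sum_(i | i != ord0) u.2 i + u.1.
  under eq_bigr do rewrite ffunE.
  rewrite big_split /=; congr (_ + _).
  rewrite (bigD1 b) //= big1 ?addr0 // => i /andP[_ /negPf->] //.
apply/eqP; rewrite -(eqn_pmul2l (ltn0Sn r.+1)) -expnS; apply/eqP.
have cX : #|setX [set: 'I_p] zero_sum| = (p * #|zero_sum|)%N.
  by rewrite cardsX cardsT card_ord.
have cF : #|{: {ffun 'I_N.+1 -> 'I_p}}| = (p ^ N.+1)%N.
  by rewrite card_ffun !card_ord.
rewrite -cX -cF.
have inj_g : {in setX [set: 'I_p] zero_sum &, injective g}.
  move=> [t a] [t' a']; rewrite !inE /= => /eqP sa /eqP sa' e.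
  have et : t = t' by have := sumg (t, a); rewrite e sumg /= sa sa' !add0r.
  congr pair => //; apply/ffunP=> i; have := congr1 (fun h : {ffun _ -> _} => h i) e.
  by rewrite !ffunE /= et => /addIr.
rewrite -(card_in_imset inj_g) -cardsT; congr #|pred_of_set _|.
apply/setP=> a; rewrite inE; apply/imsetP.
exists (\sum_(i | i != ord0) a i,
  [ffun i => a i - if i == b then \sum_(i | i != ord0) a i else 0]).
  rewrite !inE /=; under eq_bigr do rewrite ffunE.
  rewrite sumrB; move: (\sum_(i | i != ord0) a i) => S.
  rewrite (bigD1 b) //= big1 ?addr0 ?subrr // => i.
  by case/andP=> _ /negPf->.
by apply/ffunP=> i; rewrite !ffunE /= subrK.
Qed.

Definition wreath_set : {set 'S_n} :=
  [set wr (lift0_perm u.1) u.2 | u in setX [set: 'S_N] zero_sum].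

Lemma wreath_setP h : reflect
  (exists s a, [/\ h = wr (lift0_perm s) a & \sum_(i | i != ord0) a i = 0])
  (h \in wreath_set).
Proof.
apply: (iffP imsetP) => [[[s a]] | [s [a [-> sa]]]].
  by rewrite !inE /= => /eqP sa ->; exists s, a.
by exists (s, a); rewrite // !inE /= sa.
Qed.

Lemma wreath_group_set : group_set wreath_set.
Proof.
apply/group_setP; split=> [|g h].
  apply/wreath_setP; exists 1%g, [ffun=> 0].
  by rewrite /lift0_perm lift_perm1 wr1 big1 // => i _; rewrite ffunE.
move=> /wreath_setP[s [a [-> sa]]] /wreath_setP[t [b [-> sb]]].
apply/wreath_setP; exists (s * t)%g, [ffun i => a i + b (lift0_perm s i)].
rewrite wrM /lift0_perm lift_permM; split=> //.
under eq_bigr do rewrite ffunE.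
rewrite big_split /= sa add0r -[RHS]sb [RHS](reindex_inj (@perm_inj _ (lift0_perm s))) /=.
by apply: eq_bigl => i; rewrite lift0_perm_eq0.
Qed.

Definition wreath_group := Group wreath_group_set.

Lemma card_wreath : #|wreath_group| = (N`! * p ^ N)%N.
Proof.
rewrite card_in_imset; first by rewrite cardsX cardsT card_Sn card_zero_sum.
move=> [s a] [t b] _ _ /= e; have [est eab] := wr_injective e.
congr pair => //; apply/permP=> i; apply: (@lift_inj _ ord0).
by rewrite -!lift0_perm_lift est.
Qed.

Lemma moved_block_rot b : moved (rotP (pred1 b)) = [set x | blk x == b].
Proof.
apply/setP=> x; rewrite !inE -[x](pntK x) block_rotE blkK /=.
case: (blk x =P b) => _; last by rewrite addr0 eqxx.
rewrite (eq_pnt blkK posK pntK) blkK posK eqxx /=.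
by rewrite -[X in _ == X]addr0 (inj_eq (addrI _)) oner_eq0.
Qed.

Lemma card_block b : #|[set x | blk x == b]| = p.
Proof.
have -> : [set x | blk x == b] = [set pnt b j | j : 'I_p].
  apply/setP=> x; rewrite inE; apply/eqP/imsetP => [xb | [j _ ->]]; last exact: blkK.
  by exists (pos x); rewrite // -xb pntK.
rewrite card_imset ?card_ord // => i j e.
by rewrite -[i](posK b) e posK.
Qed.

(** A nontrivial permutation of the blocks moves all points of two blocks at
    least.  So the blocks are fixed, and a single one of them is rotated; it is
    not a block of X, as the rotations of the blocks of X cancel. *)
Lemma wreath_moved h : h \in wreath_group -> h != 1%g -> (#|moved h| <= p)%N ->
  moved h = [set x | blk x == ord0].
Proof.
move=> /wreath_setP[s0 [a [-> suma]]]; set s := lift0_perm s0 => h1 hp.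
have blkm i (s_i : s i != i) : [set x | blk x == i] \subset moved (wr s a).
  apply/subsetP=> x; rewrite !inE => /eqP xi; apply: contraNneq s_i => e.
  by have := congr1 blk e; rewrite blk_wr xi => ->.
have s1 : s = 1%g.
  apply/permP=> i; rewrite perm1; apply/eqP/negPn/negP=> si.
  have ssi : s (s i) != s i by rewrite (inj_eq perm_inj).
  have disj : [disjoint [set x | blk x == i] & [set x | blk x == s i]].
    rewrite -setI_eq0; apply/eqP/setP=> x; rewrite !inE.
    by case: eqP => // ->; rewrite eq_sym (negPf si).
  have : ([set x | blk x == i] :|: [set x | blk x == s i]) \subset moved (wr s a).
    by rewrite subUset !blkm.
  move/subset_leq_card; rewrite cardsU disjoint_setI0 // cards0 subn0 !card_block.
  by move/leq_trans/(_ hp); lia.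
have blka i : a i != 0 -> [set x | blk x == i] \subset moved (wr s a).
  move=> ai; apply/subsetP=> x; rewrite !inE => /eqP xi.
  rewrite -[x](pntK x) wrE (eq_pnt blkK posK pntK) s1 perm1 blkK posK eqxx /= xi.
  by rewrite -[X in _ == X]addr0 (inj_eq (addrI _)).
have uniq_a i j : a i != 0 -> a j != 0 -> i = j.
  move=> ai aj; apply/eqP/negPn/negP=> ij.
  have disj : [disjoint [set x | blk x == i] & [set x | blk x == j]].
    rewrite -setI_eq0; apply/eqP/setP=> x; rewrite !inE.
    by case: eqP => // ->; rewrite (negPf ij).
  have : ([set x | blk x == i] :|: [set x | blk x == j]) \subset moved (wr s a).
    by rewrite subUset !blka.
  move/subset_leq_card; rewrite cardsU disjoint_setI0 // cards0 subn0 !card_block.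
  by move/leq_trans/(_ hp); lia.
have [i ai] : exists i, a i != 0.
  apply/existsP; apply: contraNT h1; rewrite negb_exists => /forallP a0.
  rewrite s1; apply/eqP/(eq_on_points pntK) => i j.
  by have := a0 i; rewrite negbK wrE !perm1 => /eqP->; rewrite addr0.
have i0 : i = ord0.
  apply/eqP/negPn/negP=> i0; move: suma; rewrite (bigD1 i) //= big1 ?addr0.
    by move=> e; rewrite e eqxx in ai.
  move=> j /andP[_ ji]; apply/eqP/negPn/negP=> aj.
  by rewrite (uniq_a i j) ?eqxx in ji.
apply/esym/eqP; rewrite -i0 eqEcard blka //=.
by rewrite card_block.
Qed.

End WreathGroup.

Section HookVertex.
Variables (F : fieldType) (r N : nat).
Local Notation p := r.+2.
Local Notation q := r.+1.
Local Notation m := (N * p)%N.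
Local Notation n := (p + m)%N.
Local Notation la := (hook n p).
Local Notation rD := (simple_repr n la F).
Local Notation d := (\rank (cokermx (mx_rad (specht_repr n la F)))).
Local Notation omega := (@hook_class q m F).
Hypothesis charF : p \in [pchar F].
Hypotheses (r0 : (0 < r)%N) (pN : (p %| N)%N) (N0 : (0 < N)%N).

Let N3 : (3 <= N)%N.
Proof. by apply: leq_trans (dvdn_leq N0 pN). Qed.

Let m0 : (0 < m)%N. Proof. by rewrite muln_gt0 N0. Qed.

Lemma pnt_subproof (i : 'I_N.+1) (j : 'I_p) : (j + i * p < n)%N.
Proof. by case: i j => i iN [j jp] /=; nia. Qed.
Definition pnt i j : 'I_n := Ordinal (pnt_subproof i j).

Lemma blk_subproof (x : 'I_n) : (x %/ p < N.+1)%N.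
Proof. by rewrite ltn_divLR // mulSn. Qed.
Definition blk (x : 'I_n) : 'I_N.+1 := Ordinal (blk_subproof x).

Definition pos (x : 'I_n) : 'I_p := Ordinal (ltn_pmod x (ltn0Sn q)).

Lemma blkK i j : blk (pnt i j) = i.
Proof. by apply/val_inj; rewrite /= addnC divnMDl // divn_small ?addn0. Qed.
Lemma posK i j : pos (pnt i j) = j.
Proof. by apply/val_inj; rewrite /= addnC modnMDl modn_small. Qed.
Lemma pntK x : pnt (blk x) (pos x) = x.
Proof. by apply/val_inj; rewrite /= addnC -divn_eq. Qed.

Local Notation rotP := (block_rot blkK posK pntK).

Lemma prime_p : prime p. Proof. exact: pcharf_prime charF. Qed.

(** n is (N + 1) p and the group has order N`! p^N; p does not divide N + 1. *)
Lemma logn_hook : logn p n`! = (logn p #|wreath_group blkK posK pntK|).+1.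
Proof.
rewrite (card_wreath blkK posK pntK N0) -[n]/(N.+1 * p)%N.
rewrite logn_fact_mul ?prime_p // factS.
rewrite !lognM ?fact_gt0 ?expn_gt0 // pfactorK ?prime_p //.
rewrite (_ : logn p N.+1 = 0%N) ?add0n; first by lia.
rewrite lognE prime_p /=; case: ifP => // pN1; move: pN1.
by rewrite -[N.+1]addn1 dvdn_addr // dvdn1.
Qed.

Lemma p_group_cycle P : (p.-group <[rotP P]>)%g.
Proof.
rewrite /pgroup -orderE; apply: (@pnat_dvd _ p); last exact: pnat_id prime_p.
by rewrite order_dvdn block_rot_order.
Qed.

(** A p-subgroup H of maximal order in G1 and the group E generated by the cycles
    of two blocks both lie in conjugates of Q, and no conjugate of E lies in H. *)
Theorem relatively_projective_pfactor (Q : {group 'S_n}) (sQ : Q \subset [set: 'S_n]) :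
  relatively_projective rD sQ -> (p ^ logn p n`! %| #|Q|)%N.
Proof.
case/relatively_projective_coset_family=> f [sumf f_act].
pose G1 := wreath_group blkK posK pntK.
have [H sylH] := Sylow_exists p G1.
have sHG : H \subset G1 by apply: pHall_sub sylH.
have pH : (p.-group H)%g by apply: pHall_pgroup sylH.
have [x Hx] : exists x, (H \subset Q :^ x)%g.
  apply: (wreath_pair_conj (blkK := blkK) (posK := posK) (pntK := pntK)
    charF r0 m0 pN N3 sumf f_act pH) => h Hh.
  have /wreath_setP[s [a [-> suma]]] := subsetP sHG h Hh.
  by exists (lift0_perm s), a; rewrite lift0_perm0.
have N1 : (1 < N.+1)%N by exact: ltnW (ltnW N3).
have N2 : (2 < N.+1)%N by exact: ltnW N3.
have N3' : (3 < N.+1)%N by exact: N3.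
pose i1 := Ordinal N1; pose i2 := Ordinal N2; pose i3 := Ordinal N3'.
pose c0 := rotP (pred1 ord0); pose c1 := rotP (pred1 i1).
pose E := (<[c0]> <*> <[c1]>)%G.
have cc : commute c0 c1 by apply: wr_commute_block_rot => i; rewrite perm1.
have pE : (p.-group E)%g.
  rewrite /= cent_joinEr ?pgroupM ?p_group_cycle //.
  by rewrite cycle_subG /= cent_cycle; apply/cent1P.
have [y Ey] : exists y, (E \subset Q :^ y)%g.
  (* E moves neither i2 nor i3; the second point is taken off the block i2 in
     order that A be the identity on the points of i2 other than the first. *)
  pose A : 'M[F]_(q, n) := \matrix_l (ev F pnt i2 (lift ord0 l) - ev F pnt i3 0).
  have A0 : A *m const_mx 1 = 0 :> 'cV_q.
    by apply/row_matrixP=> l; rewrite row_mul rowK mulmxBl !ev_sum subrr row0.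
  have kX := sumX0 (step_rows_sumX F blkK posK pntK (isT : i2 != ord0)).
  have fixA P : P i2 = false -> P i3 = false -> A *m perm_mx (rotP P) = A.
    move=> P2 P3; apply/row_matrixP=> l; rewrite row_mul !rowK mulmxBl !ev_rot.
    by rewrite P2 P3 !addr0.
  have fixk P : P i2 = false -> step_rows F pnt i2 *m perm_mx (rotP P) = step_rows F pnt i2.
    move=> P2; apply/row_matrixP=> l; rewrite row_mul !rowK mulmxBl !ev_rot.
    by rewrite P2 !addr0.
  apply: (fixed_pair_conj charF r0 m0 sumf f_act (t := omega A) (v := step_class F pnt i2) pE).
    suff sE : E \subset rstab rD (omega A) :&: rstab rD (step_class F pnt i2).
      move=> g Eg; have /setIP[gA gt] := subsetP sE g Eg.
      split; first exact: (rstab_act gA (submx_refl _)).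
      exact: (rstab_act gt (submx_refl _)).
    have memr w g : w *m rD g = w -> g \in rstab rD w.
      by move=> wg; apply/setIdP; split; [exact: in_setT | apply/eqP; exact: wg].
    have memE P : P i2 = false -> P i3 = false ->
        rotP P \in rstab rD (omega A) :&: rstab rD (step_class F pnt i2).
      move=> P2 P3; apply/setIP; split; apply: memr.
        by rewrite (hook_class_act _ A0) (fixA _ P2 P3).
      by rewrite (hook_class_act _ kX) (fixk _ P2).
    by rewrite join_subG !cycle_subG; apply/andP; split; apply: memE.
  apply: (dform_step_class_neq0 charF r0 m0 blkK posK pntK) => // l j.
  rewrite !mxE !(eq_pnt blkK posK pntK) blkK posK eqxx /=.
  by rewrite subr0.
have [ltH | leH] := ltnP #|H| #|Q|`_p.
  rewrite p_part /= in ltH; rewrite pfactor_dvdn ?prime_p ?cardG_gt0 // logn_hook.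
  rewrite (card_Hall sylH) p_part ltn_exp2l ?prime_gt1 ?prime_p // in ltH.
have [g sEg] := pgroup_conj_into pH pE Hx Ey leH.
have inv b : rotP (pred1 b) \in E -> (g @: [set u | blk u == b]) = [set u | blk u == ord0].
  move=> Eb; rewrite -(moved_block_rot blkK posK pntK) -moved_conj.
  have Hb : (rotP (pred1 b) ^ g)%g \in G1.
    by apply: (subsetP sHG); apply: (subsetP sEg); rewrite memJ_conjg.
  have cb : #|moved (rotP (pred1 b) ^ g)%g| = p.
    rewrite moved_conj card_imset; last exact: perm_inj.
    by rewrite moved_block_rot (card_block blkK posK pntK).
  apply: (wreath_moved N0 Hb); last by rewrite cb.
  apply/eqP=> b1; have := cb; rewrite b1 /moved.
  rewrite (_ : [set _ | _] = set0) ?cards0 //.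
  by apply/setP=> u; rewrite !inE perm1 eqxx.
have E0 : c0 \in E by apply: (subsetP (joing_subl _ _)); apply: cycle_id.
have E1 : c1 \in E by apply: (subsetP (joing_subr _ _)); apply: cycle_id.
have /(imset_inj (@perm_inj _ g))/setP/(_ (pnt ord0 0)) := etrans (inv _ E0) (esym (inv _ E1)).
by rewrite !inE blkK eqxx.
Qed.


End HookVertex.

(** * Vertices *)

(** For n <= p the list that represents the hook consists of p ones. *)
Lemma p_regular_hook_lt n p : (1 < p)%N -> p_regular p (hook n p) -> (p < n)%N.
Proof.
move=> p1 /(_ 1%N isT); rewrite /hook /= count_nseq /= mul1n ltnNge => h.
rewrite ltnNge; apply: contra h => np.
by rewrite (eqP (np : n - p == 0)%N) /= add1n prednK // ltnW.
Qed.

Lemma eqmod_sqr n p : (1 < p)%N -> (p < n)%N -> n = p %[mod p ^ 2] ->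
  exists N, [/\ n = (p + N * p)%N, (p %| N)%N & (0 < N)%N].
Proof.
move=> p1 pn /eqP; rewrite eqn_mod_dvd; last exact: ltnW.
case/dvdnP=> k e; exists (k * p)%N; rewrite dvdn_mull //; split=> //.
  by rewrite -mulnA mulnn -e subnKC // ltnW.
have : (0 < n - p)%N by rewrite subn_gt0.
by rewrite e !muln_gt0 => /andP[-> _]; rewrite ltnW.
Qed.

Section VertexSylow.
Variables (F : fieldType) (gT : finGroupType) (G : {group gT}) (n p : nat).
Variable rG : mx_representation F G n.
Hypotheses (charF : p \in [pchar F]) (indec : mx_indecomposable rG).
Hypothesis large : forall (Q : {group gT}) (sQG : Q \subset G),
  relatively_projective rG sQG -> (#|G|`_p %| #|Q|)%N.

(** The index of a Sylow p-subgroup is prime to p, so the module is projective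
    relative to it, and [large] leaves no smaller candidate. *)
Lemma vertex_sylow (Q : {group gT}) : is_vertex rG Q <-> (p.-Sylow(G) Q)%g.
Proof.
have pr : prime p := pcharf_prime charF.
have rel_syl (R : {group gT}) (sRG : R \subset G) :
    (p.-Sylow(G) R)%g -> relatively_projective rG sRG.
  move=> sylR; apply: relatively_projective_index.
  rewrite -(dvdn_pcharf charF) -p'natE //.
  by case/and3P: sylR.
split=> [[_ [sQG [relQ minQ]]] | sylQ].
  have [R sylR] := Sylow_exists p Q.
  have sRQ := pHall_sub sylR.
  have sylGR : (p.-Sylow(G) R)%g.
    rewrite pHallE (subset_trans sRQ sQG) /= (card_Hall sylR) eqn_dvd.
    rewrite partn_dvd ?cardSg ?cardG_gt0 //=.
    rewrite -(part_pnat_id (part_pnat p #|G|)).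
    by rewrite partn_dvd ?cardG_gt0 ?large.
  have /= QR := minQ R sRQ (rel_syl R _ sylGR).
  by rewrite (_ : Q = R) //; apply/group_inj.
split=> //; exists (pHall_sub sylQ); split; first exact: rel_syl.
move=> R sRQ relR; apply/eqP; rewrite eqEcard sRQ (card_Hall sylQ).
exact: dvdn_leq (large relR).
Qed.

End VertexSylow.

Theorem theorem1p1 (p : nat) (F : fieldType) (n : nat) :
  prime p -> (2 < p)%N -> p \in [pchar F]%R -> n = p %[mod p ^ 2] ->
  p_regular p (hook n p) ->
  forall Q : {group 'S_n},
    is_vertex (simple_repr n (hook n p) F) Q <-> (p.-Sylow([set: 'S_n]) Q)%g.
Proof.
move=> pr p2 charF np reg Q; have p1 := prime_gt1 pr.
have [N [En pN N0]] := eqmod_sqr p1 (p_regular_hook_lt p1 reg) np.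
case: p pr p2 charF p1 pN En {np reg} => [|[|r]] // pr r0 charF p1 pN En.
subst n; apply: (vertex_sylow charF).
  by apply: hook_simple_indecomposable => //; rewrite muln_gt0 N0.
move=> R sRG /(relatively_projective_pfactor charF r0 pN N0).
by rewrite cardsT card_Sn p_part.
Qed.
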